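(* For every integer $n \ge 4$, $ex_{_\mathcal{P}}(n,\Theta_4)\leq \frac{12(n-2)}{5}$. Moreover, equality $ex_{_\mathcal{P}}(n,\Theta_4)= \frac{12(n-2)}{5}$ holds for every such $n$ with $n\equiv 12 \pmod{20}$.
   Context: All graphs are finite and simple. For a family $\mathcal{F}$ of graphs, a graph is $\mathcal{F}$-free if it contains no graph in $\mathcal{F}$ as a (not necessarily induced) subgraph. The planar Turán number $ex_{_\mathcal{P}}(n,\mathcal{F})$ is the maximum number of edges in an $\mathcal{F}$-free planar graph on $n$ vertices; when $\mathcal{F}=\{F\}$ one writes $ex_{_\mathcal{P}}(n,F)$. A Theta graph is a graph on at least $4$ vertices obtained from a cycle by adding one additional edge joining two non-consecutive vertices of the cycle. For an integer $k\ge 4$, $\Theta_k$ denotes the family of all non-isomorphic Theta graphs on $k$ vertices. The family $\Theta_4$ consists of a single graph, namely $K_4$ minus one edge, which is also denoted $\Theta_4$. *)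

(* Defs.v *)
From HB Require Import structures.
From mathcomp Require Import all_boot all_order all_algebra.
From mathcomp Require Import boolp classical_sets reals.
From mathcomp Require Import topology normedtype.
Set Implicit Arguments.
Unset Strict Implicit.
Unset Printing Implicit Defensive.
Import Order.TTheory GRing.Theory Num.Theory.
Import numFieldNormedType.Exports.

(** Finite simple graphs with vertex set [V]. *)
Record sgraph (V : finType) := SGraph {
  edges : {set {set V}};
  edges_card2 : [forall e in edges, #|e| == 2]
}.

HB.instance Definition _ (V : finType) := [isSub for @edges V].
HB.instance Definition _ (V : finType) := [Finite of sgraph V by <:].

(** Not necessarily induced copies of [H] in [G]. *)
Definition contains (V W : finType) (G : sgraph V) (H : sgraph W) : Prop :=
  exists2 f : W -> V, injective f & forall e, e \in edges H -> f @: e \in edges G.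

Definition graph_family := forall W : finType, sgraph W -> Prop.

Definition free (V : finType) (F : graph_family) (G : sgraph V) : Prop :=
  forall (W : finType) (H : sgraph W), F W H -> ~ contains G H.

(** [ordS] is the successor modulo [k], so this is the edge set of the cycle
    [c 0, c 1, ..., c (k - 1)] when [c] is injective and [3 <= k]. *)
Definition cycle_edges (k : nat) (W : finType) (c : 'I_k -> W) : {set {set W}} :=
  [set [set c i; c (ordS i)]%SET | i : 'I_k]%SET.

(** The family is closed under isomorphism, rather than having one member per
    isomorphism class; this does not change which graphs are [Theta k]-free. *)
Definition Theta (k : nat) : graph_family := fun W H =>
  4 <= k /\
  exists2 c : 'I_k -> W, bijective c &
  exists x y : W,
    [/\ x != y,
        [set x; y]%SET \notin cycle_edges c &
        edges H = ([set x; y] |: cycle_edges c)%SET].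

Local Open Scope ring_scope.

(** A drawing in the plane without crossings: vertices are distinct points
    [p x], each edge [e] is a simple arc [g e] from [p x] to [p y] where
    [e = {x, y}], and the interior of an arc meets no vertex and no other arc. *)
Definition plane_drawing (R : realType) (V : finType) (G : sgraph V)
    (p : V -> R * R) (g : {set V} -> R -> R * R) : Prop :=
  [/\ injective p,
      forall e, e \in edges G ->
        {within `[0, 1], continuous (g e)}%classic /\
        {in `[0, 1] &, injective (g e)},
      forall e, e \in edges G ->
        exists x y : V, [/\ e = [set x; y]%SET, g e 0 = p x & g e 1 = p y],
      forall e (x : V) t, e \in edges G -> t \in `]0, 1[ -> g e t <> p x &
      forall e e' s t, e \in edges G -> e' \in edges G -> e != e' ->
        s \in `]0, 1[ -> t \in `]0, 1[ -> g e s <> g e' t].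

Definition planar (R : realType) (V : finType) (G : sgraph V) : Prop :=
  exists (p : V -> R * R) (g : {set V} -> R -> R * R), plane_drawing G p g.

Definition ex_planar (R : realType) (n : nat) (F : graph_family) : nat :=
  \max_(G : sgraph 'I_n | `[< planar R G /\ free F G >]) #|edges G|.

(* Main.v *)
Require Import Defs.
From mathcomp Require Import all_boot all_order all_algebra.
From mathcomp Require Import reals.
From mathcomp Require Import zify ring lra.
(* Upper bound. The drawing is rasterised on a fine square grid: the ends of the
   arcs at a vertex become a connected set of cells, and the middle of each arc
   becomes a path of cells joining two such sets, so the graph is a minor of the
   grid. In the grid every even edge set bounds a set of corners (the parity of the
   crossings with a horizontal ray), and classes of corners not separated by the
   minor serve as faces. The boundaries of the faces are even, cover each edge at
   most twice, and span the cycle space, whose cardinal is at least 2^(e-n+1);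
   together with their linear dependency this gives at least e-n+2 boundaries. Since
   the graph is Theta_4-free, distinct triangles are edge-disjoint, so at most e/3
   boundaries are triangles, and 4(e-n+2) <= 2e + e/3.

   Lower bound. Cuboctahedra, seen as three concentric squares, are nested in one
   another and consecutive ones are joined through a ring of eight vertices; every
   edge then lies between a triangle and a quadrangle. The drawing is invariant
   under z |-> 6(1+i)z up to its two ends, so only one period has to be checked. *)

Import Order.TTheory GRing.Theory Num.Theory.
Set Implicit Arguments.
Unset Strict Implicit.
Unset Printing Implicit Defensive.

(** * Counting faces in a combinatorial dual *)

Lemma big_addb_eq (I : finType) (x : I) (P : pred I) (f : I -> bool) :
  \big[addb/false]_(i | P i) ((i == x) && f i) = P x && f x.
Proof.
rewrite big_mkcond (bigD1 x) //= eqxx big1 ?addbF; first by case: (P x).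
by move=> i /negbTE->; case: (P i).
Qed.

(** * Even edge sets: the cycle space over the field with two elements *)

Section EvenSets.
Variable V : finType.
Implicit Types (X Y : {set {set V}}) (e : {set V}) (v : V).

Definition odd_deg X v := \big[addb/false]_(e : {set V} | v \in e) (e \in X).

Definition even_set X := [forall v, ~~ odd_deg X v].

Definition symd X Y := [set e | (e \in X) (+) (e \in Y)].

Lemma odd_deg_symd X Y v : odd_deg (symd X Y) v = odd_deg X v (+) odd_deg Y v.
Proof. by rewrite /odd_deg -big_split; apply: eq_bigr => e _; rewrite inE. Qed.

Lemma symd_inj Y : injective (symd^~ Y).
Proof.
move=> X1 X2 /setP eqX; apply/setP=> e.
by have := eqX e; rewrite !inE => /(can_inj (addbK _)).
Qed.

Lemma handshake X : {in X, forall e, #|e| = 2} ->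
  \big[addb/false]_v odd_deg X v = false.
Proof.
move=> card2; rewrite /odd_deg.
under eq_bigr do rewrite big_mkcond.
rewrite exchange_big big1 // => e _.
have [eX|eX] := boolP (e \in X); last by rewrite big1 // => v _; case: ifP.
have -> : \big[addb/false]_v (if v \in e then true else false) = odd #|e|.
  rewrite -sum1_card (big_morph odd oddD (erefl : odd 0 = false)) /=.
  by rewrite [RHS]big_mkcond.
by rewrite card2.
Qed.

(** Group the subsets of [E] by their odd vertices other than [v0]. There are at most 2^(n-1)
    classes, and [symd] with a fixed member of a class maps the class injectively into the even
    sets. *)
Lemma card_even_sets (E : {set {set V}}) (v0 : V) : {in E, forall e, #|e| = 2} ->
  2 ^ #|E| <= 2 ^ #|V|.-1 * #|[set X in powerset E | even_set X]|.
Proof.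
move=> card2; set Z := [set X in _ | _].
(* By [handshake] the parity at [v0] follows from the others; dropping it gives the exponent
   [#|V|.-1]. *)
pose f X := [set v | odd_deg X v] :\ v0.
rewrite -card_powerset -sum1_card.
rewrite (partition_big f (mem (powerset (~: [set v0])))) /=; last first.
  by move=> X _; rewrite powersetE; apply/subsetP=> v; rewrite !inE => /andP[].
have -> : 2 ^ #|V|.-1 = #|powerset (~: [set v0])|.
  by rewrite card_powerset; congr (2 ^ _); have := cardsC1 v0; lia.
rewrite -sum_nat_const; apply: leq_sum => Y _; rewrite sum1dep_card.
have [->|[X0]] := set_0Vmem [set X | X \in powerset E & f X == Y].
  by rewrite cards0.
rewrite inE => /andP[X0E /eqP fX0].
rewrite -(card_imset _ (@symd_inj X0)); apply/subset_leq_card/subsetP=> S /imsetP[X].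
rewrite inE => /andP[XE /eqP fX] ->{S}.
move: X0E XE; rewrite !powersetE => X0E XE.
have sE : symd X X0 \subset E.
  apply/subsetP=> e; rewrite inE; have := subsetP X0E e; have := subsetP XE e.
  by case: (e \in X); case: (e \in X0) => //= h1 h2 _; apply: h1 || apply: h2.
rewrite inE powersetE sE /=; apply/forallP=> v.
have oddv0 w : w != v0 -> odd_deg (symd X X0) w = false.
  move=> wv0; have /setP/(_ w) : f X = f X0 by rewrite fX.
  by rewrite !inE wv0 /= odd_deg_symd => ->; rewrite addbb.
have [->|/oddv0->//] := eqVneq v v0.
have [|hs] := eqVneq (odd_deg (symd X X0) v0) false; first by move->.
have := @handshake (symd X X0); rewrite (bigD1 v0) //= [X in _ (+) X]big1 ?addbF => [->//|w].
  by move=> e /(subsetP sE)/card2.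
exact: oddv0.
Qed.

Lemma even_set_next X e v : even_set X -> e \in X -> v \in e ->
  exists e', [/\ e' \in X, v \in e' & e' != e].
Proof.
move=> /forallP/(_ v) ev eX ve.
have [/existsP[e' /and3P[]]|/existsPn noe'] :=
  boolP [exists e', [&& e' \in X, v \in e' & e' != e]]; first by move=> *; exists e'.
move: ev; rewrite /odd_deg (bigD1 e) //= eX big1 // => e' /andP[ve' e'e].
by have := noe' e'; rewrite ve' e'e !andbT => /negbTE.
Qed.

(** Parity supplies a second edge at each end of [e0]. The outer ends [c] and [d] may coincide, as
    in a triangle. *)
Lemma even_set_path X e0 : {in X, forall e, #|e| = 2} -> even_set X ->
  e0 \in X -> exists a b c d, [/\ e0 = [set a; b], a != b, c != a /\ c != b,
   d != a /\ d != b & [set a; c] \in X /\ [set b; d] \in X].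
Proof.
move=> card2 eX e0X.
have other e v : e \in X -> v \in e -> exists2 w, w != v & e = [set v; w].
  move=> /card2/eqP/cards2P[x [y [xy ->]]]; rewrite !inE => /orP[]/eqP->.
    by exists y => //; rewrite eq_sym.
  by exists x => //; rewrite setUC.
have /eqP/cards2P[a [b [ab e0E]]] := card2 _ e0X.
have [|e1 [e1X ae1 e10]] := even_set_next (v := a) eX e0X; first by rewrite e0E !inE eqxx.
have [|e2 [e2X be2 e20]] := even_set_next (v := b) eX e0X.
  by rewrite e0E !inE eqxx orbT.
have [c ca e1E] := other _ _ e1X ae1.
have [d db e2E] := other _ _ e2X be2.
exists a, b, c, d; rewrite -e1E -e2E; split=> //; split=> //.
  by apply: contraNneq e10 => cb; rewrite e0E e1E cb.
by apply: contraNneq e20 => da; rewrite e0E e2E da setUC.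
Qed.

Lemma set2_eq (a b c d : V) :
  ([set a; b] == [set c; d]) = ((a == c) && (b == d)) || ((a == d) && (b == c)).
Proof.
apply/eqP/idP=> [/setP eq|/orP[]/andP[/eqP-> /eqP->] //]; last by rewrite setUC.
have:= eq a; have := eq b; have := eq c; have := eq d; rewrite !inE !eqxx ?orbT /=.
rewrite ![d == _]eq_sym ![c == _]eq_sym.
by do 4 case: (_ == _).
Qed.

Lemma even_set_three X e0 : {in X, forall e, #|e| = 2} -> even_set X -> e0 \in X ->
  exists a b c d, [/\ e0 = [set a; b], a != b /\ c != a /\ c != b, d != a /\ d != b,
    [set [set a; b]; [set a; c]; [set b; d]] \subset X &
    #|[set [set a; b]; [set a; c]; [set b; d]]| = 3].
Proof.
move=> card2 eX e0X.
have [a [b [c [d [e0E ab [ca cb] [da db] [acX bdX]]]]]] := even_set_path card2 eX e0X.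
exists a, b, c, d; split=> //.
  by rewrite e0E in e0X; apply/subsetP=> e; rewrite !inE => /orP[/orP[]|]/eqP->.
rewrite setUC cardsU1 cards2 !inE !set2_eq !eqxx /=.
rewrite ![a == _]eq_sym ![b == _]eq_sym (negbTE ca) (negbTE cb) (negbTE da) (negbTE db) /=.
by rewrite (negbTE ab).
Qed.

Lemma even_set_ge3 X : {in X, forall e, #|e| = 2} -> even_set X -> X != set0 -> 3 <= #|X|.
Proof.
move=> card2 eX /set0Pn[e0 /(even_set_three card2 eX)[a [b [c [d [_ _ _ sub <-]]]]]].
exact: subset_leq_card.
Qed.

(** The path of three edges around [e0] exhausts [X]. Parity at [c] requires a second edge there,
    which can only be [[set b; d]], so [c = d]. *)
Lemma even_set_triangle X e0 : {in X, forall e, #|e| = 2} -> even_set X -> #|X| = 3 ->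
  e0 \in X -> exists a b c, e0 = [set a; b] /\
    X = [set [set a; b]; [set a; c]; [set b; c]].
Proof.
move=> card2 eX cX e0X.
have [a [b [c [d [e0E [ab [ca cb]] [da db] sub cT]]]]] := even_set_three card2 eX e0X.
have XE : [set [set a; b]; [set a; c]; [set b; d]] = X.
  by apply/eqP; rewrite eqEcard sub cX cT.
have cd : c = d.
  have acX : [set a; c] \in X by rewrite -XE !inE eqxx orbT.
  have [|e' [e'X ce' e'n]] := even_set_next (v := c) eX acX; first by rewrite !inE eqxx orbT.
  move: ce' e'n e'X; rewrite -XE !inE => ce' e'n /orP[/orP[]|]/eqP e'E.
  - by move: ce'; rewrite e'E !inE (negbTE ca) (negbTE cb).
  - by rewrite e'E eqxx in e'n.
  - by move: ce'; rewrite e'E !inE (negbTE cb) /= => /eqP.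
by exists a, b, c; rewrite -XE -cd.
Qed.

End EvenSets.

Section Theta4.
Variables (V : finType) (G : sgraph V).

Lemma edge_card2 : {in edges G, forall e : {set V}, #|e| = 2}.
Proof. by move=> e eG; apply/eqP/(forall_inP (edges_card2 G)). Qed.

Lemma set2_edge_neq a b : [set a; b] \in edges G -> a != b.
Proof. by move=> /edge_card2; rewrite cards2; case: (a != b). Qed.

(** Otherwise [a], [c], [b], [d] form a 4-cycle with chord [ab]. *)
Lemma theta4_free_apex (a b c d : V) : Defs.free (Theta 4) G ->
  [set a; b] \in edges G -> [set a; c] \in edges G -> [set b; c] \in edges G ->
  [set a; d] \in edges G -> [set b; d] \in edges G -> c = d.
Proof.
move=> freeG ab ac bc ad bd; apply: contraTeq isT => cd.
pose c4 : {set {set 'I_4}} := cycle_edges id.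
pose o0 : 'I_4 := inord 0; pose o2 : 'I_4 := inord 2.
have o02 : o0 != o2 by rewrite -val_eqE /= !inordK.
have c4_card2 : [forall e in [set o0; o2] |: c4, #|e| == 2].
  apply/forall_inP=> e; rewrite inE => /orP[/set1P->|/imsetP[i _ ->]].
    by rewrite cards2 o02.
  by rewrite cards2; case: i => [[|[|[|[|]]]]].
exfalso; apply: (freeG _ (SGraph c4_card2)).
  split=> //; exists id; first by exists id.
  exists o0, o2; split=> //; apply/imsetP=> -[i _ /eqP].
  rewrite set2_eq -!val_eqE /= !inordK //.
  by case: i => [[|[|[|[|]]]]].
pose f (i : 'I_4) := nth a [:: a; c; b; d] i.
have f_edge (i j : 'I_4) : [set f i; f j] \in edges G ->  f @: [set i; j] \in edges G.
  by rewrite imsetU1 imset_set1.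
exists f => [i j /eqP|e].
  rewrite nth_uniq //; first by move=> /eqP/val_inj.
  rewrite /= !inE !negb_or cd (set2_edge_neq ab) (set2_edge_neq ac) (set2_edge_neq ad).
  by rewrite (set2_edge_neq bd) eq_sym (set2_edge_neq bc).
rewrite inE => /orP[/set1P->|/imsetP[i _ ->]]; apply: f_edge.
  by rewrite /f !inordK.
by case: i => [[|[|[|[|]]]]] //= ?; rewrite /f //= setUC.
Qed.

End Theta4.

(** * Boundaries of faces and the edge bound *)

Section Counting.
Variables (V : finType) (G : sgraph V) (F : finType) (l r : {set V} -> F).

Definition face_boundary f := [set e in edges G | (l e == f) != (r e == f)].

Hypothesis faces_even : forall f, even_set (face_boundary f).
Hypothesis faces_span : forall X : {set {set V}}, X \subset edges G -> even_set X ->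
  exists S : F -> bool, {in edges G, forall e, (e \in X) = (S (l e) != S (r e))}.

Let bd := face_boundary.
(** Boundaries are counted rather than faces: equal ones are merged, and the empty one, which adds
    nothing to a sum, is discarded. *)
Definition faces : {set {set {set V}}} := [set bd f | f : F] :\ set0.

Lemma mem_bd e f : (e \in bd f) = (e \in edges G) && ((f == l e) (+) (f == r e)).
Proof.
rewrite inE (eq_sym (l e)) (eq_sym (r e)); congr (_ && _).
by case: (f == l e); case: (f == r e).
Qed.

(** [S] separates the two sides of [e] when [e] lies on an odd number of boundaries of faces chosen
    by [S]. Grouping these faces by boundary leaves one parity per boundary. *)
Lemma faces_parity (S : F -> bool) e : e \in edges G ->
  (S (l e) != S (r e)) = \big[addb/false]_(Q in faces)
     ((\big[addb/false]_(f | bd f == Q) S f) && (e \in Q)).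
Proof.
move=> eG; transitivity (\big[addb/false]_f (S f && (e \in bd f))).
  under eq_bigr do rewrite mem_bd eG /= andbC andb_addl.
  by rewrite big_split /= !(big_addb_eq _ predT) //=; case: (S _); case: (S _).
rewrite (partition_big bd predT) //= (bigD1 set0) //= big1 ?addFb; last first.
  by move=> f /eqP->; rewrite inE andbF.
rewrite [RHS]big_mkcond [LHS]big_mkcond; apply: eq_bigr => Q _.
rewrite !inE; case: eqP => //= _; case: imsetP => [_|noQ]; last first.
  by rewrite big1 // => f /eqP bdf; case: noQ; exists f.
by rewrite big_distrl /=; apply: eq_bigr => f /eqP->.
Qed.

Let Z := [set X in powerset (edges G) | even_set X].

(** The map [dec], which sums the members of a subset of [A] modulo 2, reaches every even set. *)
Lemma card_even_le (A : {set {set {set V}}}) :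
  (forall X, X \in Z -> exists2 S : F -> bool,
     {in edges G, forall e, (e \in X) = (S (l e) != S (r e))} &
     {in faces, forall Q, \big[addb/false]_(f | bd f == Q) S f -> Q \in A}) ->
  #|Z| <= 2 ^ #|A|.
Proof.
move=> spanA; rewrite -card_powerset.
pose dec (B : {set {set {set V}}}) :=
  [set e in edges G | \big[addb/false]_(Q in faces) ((Q \in B) && (e \in Q))].
apply: leq_trans (leq_imset_card dec _); apply/subset_leq_card/subsetP=> X XZ.
have [S SX SA] := spanA X XZ; move: XZ; rewrite inE powersetE => /andP[XE _].
pose B := [set Q in faces | \big[addb/false]_(f | bd f == Q) S f].
apply/imsetP; exists B.
  by rewrite powersetE; apply/subsetP=> Q; rewrite inE => /andP[/SA].
apply/setP=> e; rewrite inE; have [eG|eG] /= := boolP (e \in edges G); last first.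
  by apply: contraNF eG => /(subsetP XE).
rewrite SX // faces_parity //; apply: eq_bigr => Q QF.
by rewrite inE QF.
Qed.

Lemma card_even_le_faces : #|Z| <= 2 ^ #|faces|.
Proof.
apply: card_even_le => X; rewrite inE powersetE => /andP[XE evX].
by have [S ?] := faces_span XE evX; exists S.
Qed.

Lemma card_even_lt_faces f0 : bd f0 \in faces -> (forall f, bd f = bd f0 -> f = f0) ->
  #|Z| <= 2 ^ #|faces|.-1.
Proof.
move=> f0F uniq0; rewrite (cardsD1 (bd f0) faces) f0F /=.
apply: card_even_le => X; rewrite inE powersetE => /andP[XE evX].
have [S SX] := faces_span XE evX.
exists (fun f => S f (+) S f0) => [e eG|Q QF].
  by rewrite SX //; case: (S f0); rewrite ?addbF // !addbT; case: (S _); case: (S _).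
rewrite in_setD1 QF andbT; apply: contraTneq => ->.
rewrite (big_pred1 f0) ?addbb // => f; apply/eqP/eqP => [/uniq0|->] //.
Qed.

Lemma sum_card_le (c : nat) (A : {set {set {set V}}}) :
  {in A, forall Q : {set {set V}}, Q \subset edges G} ->
  {in edges G, forall e : {set V}, #|[set Q in A | e \in Q]| <= c} ->
  \sum_(Q in A) #|Q| <= c * #|edges G|.
Proof.
move=> sub le_c.
have -> : \sum_(Q in A) #|Q| = \sum_(Q in A) \sum_(e in edges G) (e \in Q).
  apply: eq_bigr => Q /sub QG; rewrite -sum1_card [RHS]big_mkcond [LHS]big_mkcond.
  apply: eq_bigr => e _; have := subsetP QG e.
  by case: (e \in Q) => [/(_ isT)->|_] //; case: ifP.
rewrite exchange_big mulnC -sum_nat_const; apply: leq_sum => e eG.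
apply: leq_trans (le_c e eG); rewrite -sum1dep_card big_mkcondr /=.
by apply: leq_sum => Q _; case: (e \in Q).
Qed.

Lemma faces_sub : {in faces, forall Q : {set {set V}}, Q \subset edges G}.
Proof.
move=> Q; rewrite !inE => /andP[_ /imsetP[f _ ->]].
by apply/subsetP=> e; rewrite inE => /andP[].
Qed.

Lemma faces_card2 Q : Q \in faces -> {in Q, forall e : {set V}, #|e| = 2}.
Proof. by move=> /faces_sub/subsetP QG e /QG; apply: edge_card2. Qed.

Lemma faces_even_set Q : Q \in faces -> even_set Q.
Proof. by rewrite !inE => /andP[_ /imsetP[f _ ->]]; apply: faces_even. Qed.

Lemma faces_ge3 Q : Q \in faces -> 3 <= #|Q|.
Proof.
move=> QF; apply: even_set_ge3; [exact: faces_card2|exact: faces_even_set|].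
by move: QF; rewrite !inE => /andP[].
Qed.

Lemma faces_at (e : {set V}) Q : Q \in faces -> e \in Q ->
  exists2 f, Q = bd f & (f == l e) (+) (f == r e).
Proof.
by rewrite !inE => /andP[_ /imsetP[f _ ->]]; rewrite mem_bd => /andP[_ ?]; exists f.
Qed.

(** Two triangular boundaries through an edge [ab] have the same third vertex by [theta4_free_apex],
    so distinct ones share no edge. *)
Lemma triangle_faces_le : Defs.free (Theta 4) G ->
  3 * #|[set Q in faces | #|Q| == 3]| <= #|edges G|.
Proof.
move=> freeG; set T := [set Q in _ | _]; rewrite -[leqRHS]mul1n.
rewrite mulnC -sum_nat_const.
have -> : \sum_(Q in T) 3 = \sum_(Q in T) #|Q|.
  by apply: eq_bigr => Q; rewrite inE => /andP[_ /eqP].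
apply: sum_card_le => [Q|e eG]; first by rewrite inE => /andP[/faces_sub].
have triangleE Q : Q \in [set Q in T | e \in Q] -> [/\ Q \in faces, #|Q| = 3 & e \in Q].
  by rewrite 2!in_set => /andP[/andP[-> /eqP]].
apply/card_le1_eqP => Q1 Q2 /triangleE[Q1F c1 eQ1] /triangleE[Q2F c2 eQ2].
have [a [b [c [eE Q1E]]]] := even_set_triangle (faces_card2 Q1F) (faces_even_set Q1F) c1 eQ1.
have [a' [b' [d [eE' Q2E]]]] := even_set_triangle (faces_card2 Q2F) (faces_even_set Q2F) c2 eQ2.
have {}Q2E : Q2 = [set [set a; b]; [set a; d]; [set b; d]].
  move/eqP: eE'; rewrite eE Q2E set2_eq => /orP[]/andP[/eqP-> /eqP->] //.
  by rewrite (setUC [set a'] [set b']) -!setUA (setUC [set [set a'; d]]).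
have sub1 := subsetP (faces_sub Q1F); have sub2 := subsetP (faces_sub Q2F).
have -> // : Q1 = Q2.
rewrite Q1E Q2E (@theta4_free_apex _ G a b c d freeG) //;
  by [apply: sub1; rewrite Q1E !inE eqxx ?orbT | apply: sub2; rewrite Q2E !inE eqxx ?orbT].
Qed.

Theorem dual_edge_bound : Defs.free (Theta 4) G -> 4 <= #|V| ->
  5 * #|edges G| + 24 <= 12 * #|V|.
Proof.
move=> freeG n4; have /card_gt0P[v0 _] : 0 < #|V| by lia.
have Zge := card_even_sets v0 (@edge_card2 _ G).
have le_exp k : #|Z| <= 2 ^ k -> #|edges G| <= #|V|.-1 + k.
  move=> Zk; rewrite -(leq_exp2l _ _ (isT : 1 < 2)) expnD.
  by apply: leq_trans Zge _; rewrite leq_mul2l Zk orbT.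
have le2 (e : {set V}) (B : {set {set {set V}}}) :
    {in B, forall Q, Q = bd (l e) \/ Q = bd (r e)} -> #|B| <= 2.
  move=> sub; apply: leq_trans (_ : #|[set bd (l e); bd (r e)]| <= 2).
    apply/subset_leq_card/subsetP=> Q /sub; rewrite !inE.
    by case=> ->; rewrite eqxx ?orbT.
  by rewrite cards2; case: (_ != _).
(* If every boundary is shared by two faces, then the boundaries are pairwise
   disjoint, which compensates for the missing linear dependency. *)
have [/exists_inP[Q QF /existsP[f0 /andP[/eqP QE /forallP uniq0]]]|double] := boolP
   [exists Q in faces, exists f0, (Q == bd f0) && [forall f, (bd f == bd f0) ==> (f == f0)]].
  have F_gt0 : 0 < #|faces| by apply/card_gt0P; exists Q.
  have := @card_even_lt_faces f0; rewrite -QE => /(_ QF) lt_F.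
  have {lt_F}/le_exp mF : #|Z| <= 2 ^ #|faces|.-1.
    by apply: lt_F => f /eqP bdf; apply/eqP; have := uniq0 f; rewrite -QE bdf.
  have sumF : \sum_(Q in faces) #|Q| <= 2 * #|edges G|.
    apply: sum_card_le; first exact: faces_sub.
    move=> e eG; apply: (le2 e) => Q'; rewrite inE => /andP[Q'F eQ'].
    have [f -> ] := faces_at Q'F eQ'.
    by case: eqP => [->|_]; [left|case: eqP => [->|//]; right].
  (* A triangle is counted 3 + 1 times on the right, and any other boundary has at least 4 edges. *)
  have sum4 : 4 * #|faces| <= \sum_(Q in faces) #|Q| + #|[set Q in faces | #|Q| == 3]|.
    rewrite mulnC -sum_nat_const -sum1dep_card big_mkcondr -big_split /=.
    by apply: leq_sum => Q1 /faces_ge3; case: #|Q1| => [|[|[|[|q]]]].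
  by have := triangle_faces_le freeG; lia.
have sumF : \sum_(Q in faces) #|Q| <= 1 * #|edges G|.
  apply: sum_card_le; first exact: faces_sub.
  move=> e eG; apply/card_le1_eqP => Q1 Q2.
  (* Let [f] be the face beside [e] with boundary [Q]. Another face [f'] with this boundary also
     lies beside [e], hence on the other side, so both sides of [e] have boundary [Q]. *)
  have all_at Q : Q \in [set Q in faces | e \in Q] -> Q = bd (l e) /\ Q = bd (r e).
    rewrite inE => /andP[QF eQ]; have [f QE fe] := faces_at QF eQ.
    move: double; rewrite negb_exists_in => /forall_inP/(_ Q QF).
    rewrite negb_exists => /forallP/(_ f); rewrite QE eqxx /= negb_forall => /existsP[f'].
    rewrite negb_imply => /andP[/eqP bdf' f'f].
    have : e \in bd f' by rewrite bdf' -QE.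
    rewrite mem_bd eG /=; move: fe f'f; rewrite -bdf'.
    have [fl|_] := eqVneq f (l e); have [fr|_] := eqVneq f (r e) => //= _.
      by rewrite fl => /negbTE-> /= /eqP <-; rewrite bdf' fl.
    by rewrite fr => /negbTE->; rewrite addbF => /eqP <-; rewrite bdf' fr.
  by move=> /all_at[-> _] /all_at[-> _].
(* With m edges, n vertices and f boundaries, m <= n - 1 + f and 3f <= m give 2m <= 3(n - 1), which
   implies the bound from n = 4 on. *)
have := le_exp _ card_even_le_faces.
have : 3 * #|faces| <= \sum_(Q in faces) #|Q|.
  by rewrite mulnC -sum_nat_const; apply: leq_sum => Q /faces_ge3.
lia.
Qed.

End Counting.

(* [F] is the set of faces and [l e], [r e] are the faces on the two sides of
   [e]; the last clause says that every cycle separates the faces in two. *)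
Definition has_dual (V : finType) (G : sgraph V) :=
  exists (F : finType) (l r : {set V} -> F),
  (forall f, even_set (face_boundary G l r f)) /\
  (forall X : {set {set V}}, X \subset edges G -> even_set X ->
    exists S : F -> bool, {in edges G, forall e, (e \in X) = (S (l e) != S (r e))}).

(** * Duals of minors of the square grid *)

From mathcomp Require Import boolp.

Local Open Scope ring_scope.

(* The side [(a, b, false)] joins the corners [(a, b)] and [(a + 1, b)] and separates
   the cells [(a, b - 1)] and [(a, b)]; the side [(a, b, true)] joins the corners
   [(a, b)] and [(a, b + 1)] and separates the cells [(a - 1, b)] and [(a, b)]. *)
Definition cell : Type := (int * int)%type.
Definition side : Type := (int * int * bool)%type.

Definition cellm (d : side) : cell :=
  if d.2 then (d.1.1 - 1, d.1.2) else (d.1.1, d.1.2 - 1).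
Definition cellp (d : side) : cell := d.1.

Definition cor0 (d : side) : cell := d.1.
Definition cor1 (d : side) : cell :=
  if d.2 then (d.1.1, d.1.2 + 1) else (d.1.1 + 1, d.1.2).

Definition jump (S : cell -> bool) (d : side) := S (cor0 d) (+) S (cor1 d).

(** The cell [c] is in the half-infinite row of cells resting on the horizontal ray that goes right
    from the corner [z]. *)
Definition on_ray (z c : cell) := (c.2 == z.2) && (z.1 <= c.1).

(** The correction term of a vertical side [d]. The rays from its two corners enclose with [d] a
    half-infinite row of cells, and a chain from [c] to [c'] crosses the border of this row an odd
    number of times exactly when one of its ends lies in the row. *)
Definition ray_change (c c' : cell) (d : side) :=
  d.2 && (on_ray (cor0 d) c (+) on_ray (cor0 d) c').

Lemma ray_changeC c c' d : ray_change c c' d = ray_change c' c d.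
Proof. by rewrite /ray_change addbC. Qed.

Lemma ray_change_trans c' c c'' d :
  ray_change c c'' d = ray_change c c' d (+) ray_change c' c'' d.
Proof.
rewrite /ray_change; case: d.2 => //=.
by case: (on_ray _ c); case: (on_ray _ c'); case: (on_ray _ c'').
Qed.

Lemma jump_addb S S' d : jump (fun z => S z (+) S' z) d = jump S d (+) jump S' d.
Proof. by rewrite /jump addbACA. Qed.

Definition crossing (d0 : side) (z : cell) :=
  [&& ~~ d0.2, z.2 == d0.1.2 & z.1 <= d0.1.1].

(** The case of a chain with the single step through [d0]: a jump at [d0] itself, plus the
    correction term. *)
Lemma jump_crossing d0 d :
  jump (crossing d0) d = (d == d0) (+) ray_change (cellm d0) (cellp d0) d.
Proof.
case: d0 d => [[i j] []] [[a b] []]; rewrite /jump /crossing /ray_change /on_ray /=;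
  rewrite /cellm /cellp /cor0 /cor1 /= !xpair_eqE ?eqxx ?andbT ?andbF /=; lia.
Qed.

Definition inside (B : pred cell) (d : side) := B (cellm d) && B (cellp d).

(* Stands for a chain of cells of [B] from [c] to [c']: [S z] is the parity of its
   crossings with the horizontal ray from the corner [z]. *)
Definition linked (B : pred cell) (c c' : cell) := exists S : cell -> bool,
  forall d, ~~ inside B d -> jump S d = ray_change c c' d.

Lemma linked_refl B c : linked B c c.
Proof. by exists xpred0 => d _; rewrite /ray_change addbb andbF. Qed.

Lemma linked_sym B c c' : linked B c c' -> linked B c' c.
Proof. by move=> [S HS]; exists S => d /HS->; rewrite ray_changeC. Qed.

Lemma linked_trans B c' c c'' : linked B c c' -> linked B c' c'' -> linked B c c''.
Proof.
move=> [S HS] [S' HS']; exists (fun z => S z (+) S' z) => d dB.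
by rewrite jump_addb HS // HS' // -ray_change_trans.
Qed.

Lemma linked_side (B : pred cell) d : inside B d -> linked B (cellm d) (cellp d).
Proof.
move=> dB; exists (crossing d) => d'; rewrite jump_crossing.
by case: eqP => // ->; rewrite dB.
Qed.

Lemma sum_shift (f : int -> bool) (x : int) (M : nat) :
  f x = false -> f (x + M%:Z) = false ->
  \big[addb/false]_(i < M) f (x + i%:Z) = \big[addb/false]_(i < M) f (x + i%:Z + 1).
Proof.
move=> f0 fM.
have := big_ord_recl M (fun i : 'I_M.+1 => f (x + i%:Z)) : \big[addb/false]_(i < M.+1) _ = _.
rewrite big_ord_recr /= fM addbF addr0 f0 addFb => ->.
by apply: eq_bigr => i _; rewrite -addrA; congr (f (_ + _)); rewrite /bump; lia.
Qed.

(** * The dual of a graph given as a minor of the grid *)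

Section GridDual.
Variables (V : finType) (G : sgraph V) (lab : cell -> option V) (K : nat).
Hypothesis lab_bound : forall c v, lab c = Some v -> `|c.1| < K%:Z /\ `|c.2| < K%:Z.
Variables (base : V -> cell) (sd : {set V} -> side) (src dst : {set V} -> V).
Let B v : pred cell := fun c => lab c == Some v.
Hypothesis edgeE : {in edges G, forall e : {set V}, e = [set src e; dst e]}.
Hypothesis lab_src : {in edges G, forall e : {set V}, lab (cellm (sd e)) = Some (src e)}.
Hypothesis lab_dst : {in edges G, forall e : {set V}, lab (cellp (sd e)) = Some (dst e)}.
Hypothesis linked_src : {in edges G, forall e : {set V},
  linked (B (src e)) (base (src e)) (cellm (sd e))}.
Hypothesis linked_dst : {in edges G, forall e : {set V},
  linked (B (dst e)) (base (dst e)) (cellp (sd e))}.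

(** The cells labelled [v] are contracted to the vertex [v]; an internal side stands for a
    contracted edge of the grid. *)
Definition internal d := (lab (cellm d) != None) && (lab (cellm d) == lab (cellp d)).

(** Deletion and contraction are exchanged in the dual: internal sides put no constraint on [S],
    while the two corners of a side neither internal nor selected are identified. *)
Definition proper (S : cell -> bool) := forall d, ~~ internal d ->
  {in edges G, forall e : {set V}, d != sd e} -> jump S d = false.

Definition same_face z z' := forall S, proper S -> S z = S z'.

Lemma src_neq_dst e : e \in edges G -> src e != dst e.
Proof. by move=> eG; apply: (@set2_edge_neq _ G); rewrite -edgeE. Qed.

Lemma internal_sd e : e \in edges G -> internal (sd e) = false.
Proof.
move=> eG; rewrite /internal lab_src // lab_dst //=; apply/eqP => -[] /eqP.
by rewrite (negbTE (src_neq_dst eG)).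
Qed.

Lemma sd_inj : {in edges G &, injective sd}.
Proof.
move=> e e' eG e'G sdE; rewrite (edgeE eG) (edgeE e'G).
have := lab_src eG; rewrite sdE lab_src // => -[->].
by have := lab_dst eG; rewrite sdE lab_dst // => -[->].
Qed.

Lemma inside_internal v d : inside (B v) d -> internal d.
Proof. by rewrite /inside /internal /B => /andP[/eqP-> /eqP->]; rewrite eqxx. Qed.

(** The border of [B v] is the sum of the borders of its cells, and the four jumps of [S] around one
    cell cancel. Sides are regrouped by cells with [sum_shift], whose end terms vanish because
    labelled cells have coordinates below [K] in absolute value. *)
Lemma crossings_box (S : cell -> bool) v :
  \big[addb/false]_(i < (2 * K).+1) \big[addb/false]_(j < (2 * K).+1)
   \big[addb/false]_(t : bool)
     (let d := (- K%:Z + i%:Z, - K%:Z + j%:Z, t) in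
      (B v (cellm d) (+) B v (cellp d)) && jump S d) = false.
Proof.
have Bout (c : cell) : (K%:Z <= `|c.1|) || (K%:Z <= `|c.2|) -> B v c = false.
  by move=> cK; apply/eqP => /lab_bound; lia.
pose T t (a b : int) := jump S (a, b, t).
pose sumb (F : int -> int -> bool) := \big[addb/false]_(i < (2 * K).+1)
  \big[addb/false]_(j < (2 * K).+1) F (- K%:Z + i%:Z) (- K%:Z + j%:Z).
have sumbD F F' : sumb (fun a b => F a b (+) F' a b) = sumb F (+) sumb F'.
  by rewrite /sumb -big_split; apply: eq_bigr => i _; rewrite -big_split.
transitivity (sumb (fun a b => ((B v (a, b - 1) && T false a b) (+) (B v (a, b) && T false a b))
   (+) ((B v (a - 1, b) && T true a b) (+) (B v (a, b) && T true a b)))).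
  apply: eq_bigr => i _; apply: eq_bigr => j _.
  by rewrite big_bool /= !andb_addl addbC.
rewrite !sumbD.
have -> : sumb (fun a b => B v (a, b - 1) && T false a b) =
          sumb (fun a b => B v (a, b) && T false a (b + 1)).
  apply: eq_bigr => i _; rewrite (sum_shift (f := fun b => B v (_, b - 1) && T false _ b)).
  - by apply: eq_bigr => j _; rewrite addrK.
  - by rewrite Bout //=; lia.
  - by rewrite Bout //=; lia.
have -> : sumb (fun a b => B v (a - 1, b) && T true a b) =
          sumb (fun a b => B v (a, b) && T true (a + 1) b).
  rewrite /sumb exchange_big [RHS]exchange_big /=.
  apply: eq_bigr => j _; rewrite (sum_shift (f := fun a => B v (a - 1, _) && T true a _)).
  - by apply: eq_bigr => i _; rewrite addrK.
  - by rewrite Bout //=; lia.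
  - by rewrite Bout //=; lia.
rewrite -!sumbD /sumb big1 // => i _; rewrite big1 // => j _.
case: (B v _) => //=; rewrite /T /jump /cor0 /cor1 /=.
by do 4 case: (S _).
Qed.

Lemma crossing_edge (S : cell -> bool) v d : proper S ->
  (B v (cellm d) (+) B v (cellp d)) && jump S d =
  \big[addb/false]_(e : {set V} | v \in e) ((e \in edges G) && (d == sd e) && jump S d).
Proof.
move=> pS; have [dint|dint] := boolP (internal d).
  rewrite big1 => [|e _].
    by move: dint; rewrite /internal /B => /andP[_ /eqP->]; rewrite addbb.
  by have [eG|] //= := boolP (e \in edges G); case: eqP dint => // ->; rewrite internal_sd.
have [/exists_inP[e eG /eqP dE]|/exists_inPn nod] := boolP [exists e in edges G, d == sd e].
  rewrite (eq_bigr (fun e' => (e' == e) && jump S d)) => [|e' _].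
    rewrite big_addb_eq; congr (_ && _).
    rewrite /B dE lab_src // lab_dst // [in RHS](edgeE eG) !inE.
    rewrite !(inj_eq (@Some_inj _)) ![v == _]eq_sym.
    have := src_neq_dst eG.
    by have [se|_] := eqVneq (src e) v; have [de|_] := eqVneq (dst e) v; rewrite ?se ?de ?eqxx.
  congr (_ && _); rewrite dE; have [->|e'e] := eqVneq e' e; first by rewrite eG eqxx.
  apply/negP => /andP[e'G /eqP/sd_inj]; move=> /(_ eG e'G)/esym/eqP.
  by rewrite (negbTE e'e).
by rewrite pS // andbF big1 // => e _; rewrite andbF.
Qed.

(** By [crossing_edge] the degree at [v] is the sum of the jumps along the border of [B v], which
    [crossings_box] shows to be zero. *)
Lemma even_jump (S : cell -> bool) : proper S -> even_set [set e in edges G | jump S (sd e)].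
Proof.
move=> pS; apply/forallP => v; apply/negP; rewrite /odd_deg.
pose pt (x : 'I_(2 * K).+1 * 'I_(2 * K).+1 * bool) : side :=
  (- K%:Z + x.1.1%:Z, - K%:Z + x.1.2%:Z, x.2).
have pt_inj : injective pt.
  move=> [[i j] t] [[i' j'] t'] [] /addrI[eqi] /addrI[eqj] ->.
  by congr (_, _, _); apply/val_inj.
have sd_pt e : e \in edges G -> exists x, sd e = pt x.
  move=> /lab_dst/lab_bound; case: (sd e) => [[a b] t]; rewrite /cellp /= => -[aK bK].
  have iK : (absz (a + K%:Z)%R < (2 * K).+1)%N by lia.
  have jK : (absz (b + K%:Z)%R < (2 * K).+1)%N by lia.
  by exists (Ordinal iK, Ordinal jK, t); rewrite /pt /=; congr (_, _, _); lia.
have := crossings_box S v.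
rewrite pair_big pair_big /=.
under eq_bigr => x _ do rewrite (@crossing_edge S v (pt x)) //.
rewrite exchange_big /= => sum0.
suff -> : \big[addb/false]_(e : {set V} | v \in e) (e \in [set e in edges G | jump S (sd e)]) =
  false by [].
rewrite -[RHS]sum0; apply: eq_bigr => e _; rewrite inE.
have [eG|eG] /= := boolP (e \in edges G); last by rewrite big1.
have [x ex] := sd_pt _ eG; rewrite ex.
under eq_bigr => y _ do rewrite (inj_eq pt_inj).
rewrite (eq_bigr (fun y => (y == x) && jump S (pt y))) //.
by rewrite (big_addb_eq _ predT).
Qed.

(** A chain from one base to the other passes through the two label sets and the selected side; all
    its other steps cross internal sides. *)
Lemma edge_crossing e : e \in edges G -> exists S : cell -> bool, forall d, ~~ internal d ->
  jump S d = (d == sd e) (+) ray_change (base (src e)) (base (dst e)) d.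
Proof.
move=> eG; have [S1 H1] := linked_src eG; have [S2 H2] := linked_dst eG.
exists (fun z => (S1 z (+) crossing (sd e) z) (+) S2 z) => d dint.
have noin v : ~~ inside (B v) d by apply: contra dint; apply: inside_internal.
rewrite !jump_addb H1 // H2 // jump_crossing.
rewrite (ray_changeC (base (dst e))).
rewrite (ray_change_trans (cellm (sd e)) (base (src e)) (base (dst e))).
rewrite (ray_change_trans (cellp (sd e)) (cellm (sd e)) (base (dst e))).
by case: (d == _); do 3 case: (ray_change _ _ _).
Qed.

(** Each base is an end of an even number of chains, so the correction terms cancel. *)
Lemma even_set_ray (X : {set {set V}}) d : X \subset edges G -> even_set X ->
  \big[addb/false]_(e in X) ray_change (base (src e)) (base (dst e)) d = false.
Proof.
move=> XG /forallP evX; pose H v := d.2 && on_ray (cor0 d) (base v).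
transitivity (\big[addb/false]_(e in X) \big[addb/false]_(v in e) H v).
  apply: eq_bigr => e /(subsetP XG) eG.
  rewrite {3}(edgeE eG) big_setU1 ?inE ?src_neq_dst //= big_set1.
  by rewrite /ray_change /H; case: d.2.
rewrite (exchange_big_dep xpredT) //= big1 // => v _.
have /negbTE := evX v; rewrite /odd_deg => oddX.
transitivity (H v && \big[addb/false]_(e : {set V} | v \in e) (e \in X)).
  rewrite big_distrr /= big_mkcond [RHS]big_mkcond /=; apply: eq_bigr => e _.
  by case: (e \in X); case: (v \in e); rewrite ?andbT ?andbF.
by rewrite oddX andbF.
Qed.

Theorem grid_dual : has_dual G.
Proof.
(* To get a finite type of faces, a class of corners is encoded by the ends of selected sides that
   it contains. *)
pose corner (x : {set V} * bool) := if x.2 then cor1 (sd x.1) else cor0 (sd x.1).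
pose cls z := [set x | `[< same_face (corner x) z >]].
have cls_eq z z' : same_face z z' -> cls z = cls z'.
  move=> zz'; apply/setP => x; rewrite !inE; apply: asbool_equiv_eq.
  by split=> H S pS; rewrite (H S pS) (zz' S pS).
have cls_corner x z : cls (corner x) = cls z -> same_face (corner x) z.
  by move=> /setP/(_ x); rewrite !inE => eq; apply/asboolP; rewrite -eq; apply/asboolP.
exists {set {set V} * bool}, (fun e => cls (cor0 (sd e))), (fun e => cls (cor1 (sd e))).
split=> [f|X XG evX].
  have [[x fE]|nox] := pselect (exists x, cls (corner x) = f).
    pose S z := cls z == f.
    have pS : proper S.
      move=> d dint dsd; rewrite /jump /S (@cls_eq (cor0 d) (cor1 d)) ?addbb // => S' pS'.
      by have := pS' d dint dsd; rewrite /jump; do 2 case: (S' _).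
    have := even_jump pS; congr (is_true (even_set _)); apply/setP => e.
    by rewrite !inE /jump /S; congr (_ && _); do 2 case: (_ == f).
  have -> : face_boundary G (fun e => cls (cor0 (sd e))) (fun e => cls (cor1 (sd e))) f = set0.
    apply/setP => e; rewrite !inE; have [eG|//] := boolP (e \in edges G).
    have neq b : cls (corner (e, b)) == f = false.
      by apply/eqP => clsE; apply: nox; exists (e, b).
    by rewrite (neq false) (neq true).
  by apply/forallP => v; rewrite /odd_deg big1 // => e _; rewrite inE.
have /choice[sig sigE] : forall e, exists S : cell -> bool, e \in edges G ->
    forall d, ~~ internal d ->
    jump S d = (d == sd e) (+) ray_change (base (src e)) (base (dst e)) d.
  move=> e; have [/edge_crossing[S ?]|_] := boolP (e \in edges G); first by exists S.
  by exists xpred0.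
(* The chains of the edges of [X] together behave like closed curves. Among non-internal sides, [SX]
   jumps exactly at the selected sides of [X], so it is constant on faces. *)
pose SX z := \big[addb/false]_(e in X) sig e z.
have jumpSX d : ~~ internal d -> jump SX d = \big[addb/false]_(e in X) (d == sd e).
  move=> dint; transitivity (\big[addb/false]_(e in X)
      ((d == sd e) (+) ray_change (base (src e)) (base (dst e)) d)).
    rewrite /jump /SX -big_split /=; apply: eq_bigr => e /(subsetP XG) eG.
    exact: sigE.
  by rewrite big_split /= even_set_ray // addbF.
have pSX : proper SX.
  move=> d dint dsd; rewrite jumpSX // big1 // => e /(subsetP XG) eG.
  exact/negbTE/dsd.
exists (fun f => `[< exists2 x, cls (corner x) = f & SX (corner x) >]) => e eG.
have SE b : `[< exists2 x, cls (corner x) = cls (corner (e, b)) & SX (corner x) >] =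
    SX (corner (e, b)).
  apply/asboolP/idP => [[x /cls_corner/(_ _ pSX) -> //]|?]; by exists (e, b).
rewrite (SE false) (SE true) -negb_add -/(negb _) negbK.
transitivity (jump SX (sd e)); last by rewrite /jump /=.
rewrite jumpSX ?internal_sd // (eq_bigr (fun e' => (e' == e) && true)) => [|e' /(subsetP XG) e'G].
  by rewrite big_addb_eq andbT.
by rewrite andbT; apply/eqP/eqP => [/sd_inj ->|->].
Qed.

End GridDual.

(** * From drawings to the grid *)

From mathcomp Require Import classical_sets topology normedtype.
Import numFieldNormedType.Exports.

(** * Compactness of arcs *)

Section Segments.
Variable R : realType.
Implicit Types (r s t a b : R) (u v : R * R).

Lemma segment_uniform a b (P : R -> R -> Prop) :
  (forall r r' s, 0 < r' -> r' <= r -> P r s -> P r' s) ->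
  (forall s, s \in `[a, b] -> exists2 r, 0 < r &
     forall s', s' \in `[a, b] -> `|s' - s| < r -> P r s') ->
  exists2 r, 0 < r & forall s, s \in `[a, b] -> P r s.
Proof.
move=> Pmon Ploc.
have /compact_near_coveringP/(_ R (0^'+)%classic
   (fun r s => s \in `[a, b] -> P r s)) := @segment_compact R a b.
case=> [s /Ploc[r r0 Hr]|r /= r0 Hr].
  exists ([set s' | `|s' - s| < r], [set r' | 0 < r' <= r])%classic => /=.
    split.
      exists r => //= s' /=; rewrite distrC //.
    exists r => //= r' /=; rewrite sub0r normrN => rr' r'0.
    by rewrite r'0 ltW // (le_lt_trans (ler_norm _)).
  move=> [s' r'] /= [ss' /andP[r'0 r'r]] s'ab.
  exact: Pmon (Hr _ s'ab ss').
exists (r / 2); first by rewrite divr_gt0.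
move=> s sab; apply: (Hr (r / 2)) => //=; last by rewrite divr_gt0.
by rewrite sub0r normrN gtr0_norm ?divr_gt0 //; move: (r0 : 0 < r); lra.
Qed.

Definition sup_close r u v := (`|u.1 - v.1| < r) && (`|u.2 - v.2| < r).

Lemma sup_close_sym r u v : sup_close r u v = sup_close r v u.
Proof. by rewrite /sup_close distrC (distrC u.2). Qed.

Lemma sup_close_trans v r1 r2 u w : sup_close r1 u v -> sup_close r2 v w -> sup_close (r1 + r2) u w.
Proof.
move=> /andP[h1 h2] /andP[h3 h4]; apply/andP; split.
  by rewrite (le_lt_trans (ler_distD v.1 _ _)) // ltrD.
by rewrite (le_lt_trans (ler_distD v.2 _ _)) // ltrD.
Qed.

Lemma sup_close_le r r' u v : r' <= r -> sup_close r' u v -> sup_close r u v.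
Proof. by move=> r'r /andP[h1 h2]; rewrite /sup_close !(lt_le_trans _ r'r). Qed.

Lemma sup_close_eq u v : (forall r, 0 < r -> sup_close r u v) -> u = v.
Proof.
move=> uv; apply/eqP; rewrite -pair_eqE /pair_eq -![_.1 == _]subr_eq0 -![_.2 == _]subr_eq0.
rewrite -!normr_le0; apply/andP; split; rewrite leNgt; apply/negP => /uv /andP[].
  by rewrite ltxx.
by rewrite ltxx.
Qed.

Lemma within_close (f : R -> R * R) a b : {within `[a, b], continuous f}%classic ->
  forall s e, s \in `[a, b] -> 0 < e ->
  exists2 r, 0 < r & forall s', s' \in `[a, b] -> `|s' - s| < r -> sup_close e (f s') (f s).
Proof.
move=> /subspace_continuousP cf s e sab e0.
have /(cf _ sab) : nbhs (f s) [set u | sup_close e u (f s)]%classic.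
  exists ([set x | `|x - (f s).1| < e], [set x | `|x - (f s).2| < e])%classic => /=.
    by split; exists e => //= x /=; rewrite distrC.
  by move=> [x y] /= [hx hy]; rewrite /sup_close /= hx.
rewrite /nbhs /= /within /= => -[r /= r0 Hr].
exists r => // s' s'ab s's; apply: Hr => //=.
by rewrite distrC.
Qed.

Lemma uniform_close (f : R -> R * R) e : {within `[0, 1], continuous f}%classic -> 0 < e ->
  exists2 r, 0 < r & forall s s', s \in `[0, 1] -> s' \in `[0, 1] -> `|s - s'| < r ->
    sup_close e (f s) (f s').
Proof.
move=> cf e0; pose P r s := forall s', s' \in `[0, 1] -> `|s - s'| < r -> sup_close e (f s) (f s').
have [|s sI|r r0 Hr] := @segment_uniform 0 1 P.
- by move=> r r' s _ r'r Pr s' s'I ss'; apply: Pr => //; apply: lt_le_trans r'r.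
- have [|r r0 Hr] := within_close cf sI (e := e / 2); first by rewrite divr_gt0.
  exists (r / 2); first by rewrite divr_gt0.
  move=> s1 s1I s1s s2 s2I s12; rewrite [e]splitr; apply: sup_close_trans (f s) _ _ _ _ _ _.
    by apply: Hr => //; apply: lt_trans s1s _; lra.
  rewrite sup_close_sym; apply: Hr => //; rewrite (le_lt_trans (ler_distD s1 _ _)) //.
  by rewrite (distrC s2); lra.
by exists r => // s s' sI s'I ss'; apply: (Hr s sI s').
Qed.

(** Compactness is used in [t] for fixed [s], then in [s]; a separation [r] at one parameter leaves
    [r / 2] around it. *)
Lemma disjoint_far (f h : R -> R * R) (a b c d : R) :
  {within `[a, b], continuous f}%classic -> {within `[c, d], continuous h}%classic ->
  (forall s t, s \in `[a, b] -> t \in `[c, d] -> f s <> h t) ->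
  exists2 r, 0 < r & forall s t, s \in `[a, b] -> t \in `[c, d] -> ~~ sup_close r (f s) (h t).
Proof.
move=> cf ch fh.
pose P r s := forall t, t \in `[c, d] -> ~~ sup_close r (f s) (h t).
have Pmon r r' s : 0 < r' -> r' <= r -> P r s -> P r' s.
  by move=> _ r'r Pr t tI; apply: contra (Pr t tI); apply: sup_close_le.
have [s sI|r r0 Hr] := @segment_uniform a b P Pmon; last first.
  by exists r => // s t sI tI; apply: Hr.
pose Q r t := ~~ sup_close r (f s) (h t).
have Qmon r r' t : 0 < r' -> r' <= r -> Q r t -> Q r' t.
  by move=> _ r'r; apply: contra; apply: sup_close_le.
have [t tI|r r0 Hr] := @segment_uniform c d Q Qmon.
  have [r r0 Hr] : exists2 r, 0 < r & ~~ sup_close r (f s) (h t).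
    have [//|near] := pselect (exists2 r, 0 < r & ~~ sup_close r (f s) (h t)).
    case: (fh s t sI tI); apply: sup_close_eq => r r0; apply/negPn/negP => nc.
    by apply: near; exists r.
  have [|q q0 Hq] := within_close ch tI (e := r / 2); first by rewrite divr_gt0.
  exists (Num.min q (r / 2)); first by rewrite lt_min q0 divr_gt0.
  move=> t' t'I; rewrite lt_min => /andP[t'q _]; apply: contra Hr => cl.
  rewrite [r]splitr; apply: sup_close_trans (h t') _ _ _ _ _ _; last exact: Hq.
  by apply: sup_close_le cl; rewrite ge_min lexx orbT.
have [|q q0 Hq] := within_close cf sI (e := r / 2); first by rewrite divr_gt0.
exists (Num.min q (r / 2)); first by rewrite lt_min q0 divr_gt0.
move=> s' s'I; rewrite lt_min => /andP[s'q _] t tI; apply: contra (Hr t tI) => cl.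
rewrite [r]splitr; apply: sup_close_trans (f s') _ _ _ _ _ _.
  by rewrite sup_close_sym; apply: Hq.
by apply: sup_close_le cl; rewrite ge_min lexx orbT.
Qed.

End Segments.

Lemma finite_uniform (R : realType) (T : finType) (P : T -> R -> Prop) :
  (forall x r r', r' <= r -> P x r -> P x r') ->
  (forall x, exists2 r, 0 < r & P x r) -> exists2 r, 0 < r & forall x, P x r.
Proof.
move=> Pmon Pex; have /choice[f fP] : forall x, exists r, 0 < r /\ P x r.
  by move=> x; have [r] := Pex x; exists r.
exists (\big[Num.min/1]_x f x) => [|x].
  by elim/big_ind: _ => // [r r' r0 r'0|x _]; [rewrite lt_min r0|case: (fP x)].
by apply: Pmon (fP x).2; rewrite (bigD1 x) //= ge_min lexx.
Qed.

Definition adjacent (c c' : cell) := c = c' \/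
  exists d, (c = cellm d /\ c' = cellp d) \/ (c = cellp d /\ c' = cellm d).

Lemma linked_adjacent (B : pred cell) c c' : adjacent c c' -> B c -> B c' -> linked B c c'.
Proof.
case=> [->|[d [] [-> ->]]] *; first exact: linked_refl.
  by apply: linked_side; apply/andP.
by apply/linked_sym/linked_side/andP.
Qed.

Lemma linked_walk (B : pred cell) (f : nat -> cell) (a b : nat) : (a <= b)%N ->
  (forall j, (a <= j < b)%N -> adjacent (f j) (f j.+1)) ->
  (forall j, (a <= j <= b)%N -> B (f j)) -> linked B (f a) (f b).
Proof.
move=> ab; rewrite -(subnKC ab); elim: (b - a)%N => [|k IH] adj inB.
  by rewrite addn0; apply: linked_refl.
apply: linked_trans (IH _ _) _; try by move=> *; (apply: adj || apply: inB); lia.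
by rewrite addnS; apply: linked_adjacent; [apply: adj|apply: inB|apply: inB]; lia.
Qed.

Lemma adjacent_x (a a' b : int) : `|a' - a| <= 1 -> adjacent (a, b) (a', b).
Proof.
move=> aa'; have [[->]|[->|->]] : a' = a \/ a' = a + 1 \/ a' = a - 1 by lia.
- by left.
- by right; exists (a + 1, b, true); left; rewrite /cellm /= addrK.
- by right; exists (a, b, true); right.
Qed.

Lemma adjacent_y (a b b' : int) : `|b' - b| <= 1 -> adjacent (a, b) (a, b').
Proof.
move=> bb'; have [[->]|[->|->]] : b' = b \/ b' = b + 1 \/ b' = b - 1 by lia.
- by left.
- by right; exists (a, b + 1, false); left; rewrite /cellm /= addrK.
- by right; exists (a, b, false); right.
Qed.

Section GridCells.
Variables (R : realType) (eta : R).
Hypothesis eta0 : 0 < eta.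

Definition grid_cell (u : R * R) : cell := (Num.floor (u.1 / eta), Num.floor (u.2 / eta)).

Lemma floor_eq_close (x y : R) : Num.floor (x / eta) = Num.floor (y / eta) -> `|x - y| < eta.
Proof.
move=> xy; have := floor_le (x / eta); have := lt_succ_floor (x / eta).
have := floor_le (y / eta); have := lt_succ_floor (y / eta); rewrite xy intrD.
rewrite !ler_pdivlMr // !ltr_pdivrMr // => h1 h2 h3 h4.
by rewrite ltr_norml; apply/andP; split; lra.
Qed.

Lemma close_floor (x y : R) : `|x - y| < eta ->
  `|Num.floor (x / eta) - Num.floor (y / eta)| <= 1.
Proof.
move=> xy; have := floor_le (x / eta); have := lt_succ_floor (x / eta).
have := floor_le (y / eta); have := lt_succ_floor (y / eta); rewrite !intrD.
have : `|x / eta - y / eta| < 1.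
  by rewrite -mulrBl normrM normfV (gtr0_norm eta0) ltr_pdivrMr // mul1r.
move: (Num.floor _) (Num.floor _) => a b; rewrite ltr_norml => /andP[h1 h2] h3 h4 h5 h6.
have : (a%:~R : R) < (b + 2)%:~R by rewrite intrD; lra.
have : (b%:~R : R) < (a + 2)%:~R by rewrite intrD; lra.
by rewrite !ltr_int; lia.
Qed.

Lemma grid_cell_eq u v : grid_cell u = grid_cell v -> sup_close eta u v.
Proof. by case=> ux uy; apply/andP; split; apply: floor_eq_close. Qed.

End GridCells.

(** * Separating the thirds of the arcs *)

Section Drawing.
Variables (R : realType) (V : finType) (G : sgraph V).
Variables (p : V -> R * R) (g : {set V} -> R -> R * R) (src dst : {set V} -> V).
Hypothesis drawing : plane_drawing G p g.
Hypothesis edgeE : {in edges G, forall e : {set V}, e = [set src e; dst e]}.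
Hypothesis arc_src : {in edges G, forall e : {set V}, g e 0 = p (src e)}.
Hypothesis arc_dst : {in edges G, forall e : {set V}, g e 1 = p (dst e)}.

Definition third (i : 'I_3) : interval R := `[i%:R / 3, i.+1%:R / 3].

(** The outer thirds of an arc are given to its ends; the middle third remains with the arc. *)
Definition owner (e : {set V}) (i : 'I_3) : option V :=
  if i == 0%N :> nat then Some (src e) else if i == 2%N :> nat then Some (dst e) else None.

(** The pairs of thirds permitted to come close. All other pairs are disjoint compact sets, hence at
    positive distance. *)
Definition may_meet e (i : 'I_3) e' (i' : 'I_3) :=
  match owner e i, owner e' i' with
  | Some v, Some w => v == w
  | Some v, None => v \in e'
  | None, Some w => w \in e
  | None, None => e == e'
  end.

Definition endpoint (e : {set V}) (s : R) (v : V) :=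
  (s = 0 /\ v = src e) \/ (s = 1 /\ v = dst e).

Lemma third_unit i s : s \in third i -> s \in `[0, 1].
Proof.
rewrite !in_itv /= => /andP[h1 h2]; apply/andP; split.
  by apply: le_trans h1; rewrite divr_ge0.
by apply: le_trans h2 _; rewrite ler_pdivrMr // mul1r ler_nat ltn_ord.
Qed.

Lemma unit_endpoint e s : e \in edges G -> s \in `[0, 1] ->
  (s \in `]0, 1[) \/ (exists2 v, endpoint e s v & g e s = p v).
Proof.
move=> eG; rewrite !in_itv /= => /andP[s0 s1].
have [sE|sn0] := eqVneq s 0.
  by right; exists (src e); [left|rewrite sE arc_src].
have [sE|sn1] := eqVneq s 1.
  by right; exists (dst e); [right|rewrite sE arc_dst].
by left; rewrite !lt_neqAle s0 s1 eq_sym sn0 sn1.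
Qed.

Lemma arcs_meet e e' s t : e \in edges G -> e' \in edges G ->
  s \in `[0, 1] -> t \in `[0, 1] -> g e s = g e' t ->
  (e = e' /\ s = t) \/ (exists2 v, endpoint e s v & endpoint e' t v).
Proof.
move=> eG e'G sI tI gE; have [p_inj arcs _ no_vertex no_cross] := drawing.
have [ee'|ee'] := eqVneq e e'.
  by left; split=> //; apply: (arcs e eG).2 => //; rewrite gE ee'.
right; have [so|[v sv gv]] := unit_endpoint eG sI; have [to|[w tw gw]] := unit_endpoint e'G tI.
- by have := no_cross e e' s t eG e'G ee' so to.
- by have := no_vertex e w s eG so; rewrite gE gw.
- by have := no_vertex e' v t e'G to; rewrite -gE gv.
by exists v => //; rewrite (p_inj v w) // -gv -gw.
Qed.

Lemma ord3P (i : 'I_3) : [\/ i = 0%N :> nat, i = 1%N :> nat | i = 2%N :> nat].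
Proof. by case: i => [[|[|[|//]]] ?]; [constructor 1|constructor 2|constructor 3]. Qed.

Lemma endpoint_owner e i s v : s \in third i -> endpoint e s v -> owner e i = Some v.
Proof.
rewrite /third /owner in_itv /=.
by case: (ord3P i) => -> /= /andP[h1 h2] [[s01 ->]|[s01 ->]] //; exfalso;
  move: h1 h2; rewrite s01; lra.
Qed.

Lemma thirds_disjoint e i e' i' s t : e \in edges G -> e' \in edges G ->
  ~~ may_meet e i e' i' -> s \in third i -> t \in third i' -> g e s <> g e' t.
Proof.
move=> eG e'G nm si ti' /arcs_meet[]; rewrite ?(third_unit si) ?(third_unit ti') //.
  (* On one arc, equal or consecutive thirds are permitted, and the first and last share no
     parameter. *)
  move=> [ee' st]; move: nm; rewrite /may_meet -ee' /owner.
  have mem : (src e \in e) && (dst e \in e).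
    by rewrite {2 4}(edgeE eG) !inE !eqxx orbT.
  move: si ti'; rewrite /third !in_itv /= -st.
  case: (ord3P i) => ->; case: (ord3P i') => -> /=; rewrite ?eqxx //;
    move=> /andP[h1 h2] /andP[h3 h4];
    first [by case/andP: mem => h5 h6; rewrite ?h5 ?h6 | by clear -h1 h2 h3 h4; exfalso; lra].
move=> [v sv tv]; move: nm; rewrite /may_meet.
by rewrite (endpoint_owner si sv) (endpoint_owner ti' tv) eqxx.
Qed.

Lemma thirds_far : exists2 eta, 0 < eta & forall e i e' i' s t,
  e \in edges G -> e' \in edges G -> ~~ may_meet e i e' i' ->
  s \in third i -> t \in third i' -> ~~ sup_close eta (g e s) (g e' t).
Proof.
pose T : finType := ({set V} * 'I_3 * ({set V} * 'I_3))%type.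
pose P (x : T) r := x.1.1 \in edges G -> x.2.1 \in edges G ->
  ~~ may_meet x.1.1 x.1.2 x.2.1 x.2.2 -> forall s t,
  s \in third x.1.2 -> t \in third x.2.2 -> ~~ sup_close r (g x.1.1 s) (g x.2.1 t).
have [x r r' r'r Pr e1 e2 nm s t si ti|[[e i] [e' i']]|eta eta0 H] := @finite_uniform R T P.
- by apply: contra (Pr e1 e2 nm s t si ti); apply: sup_close_le.
- rewrite /P /=; have [eG|eG] := boolP (e \in edges G); last by exists 1.
  have [e'G|e'G] := boolP (e' \in edges G); last by exists 1.
  have [mm|nm] := boolP (may_meet e i e' i'); first by exists 1.
  have [_ arcs _ _ _] := drawing.
  have sub (j : 'I_3) : ([set` third j] `<=` `[0%R, 1%R])%classic by move=> s /third_unit.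
  have cts f j : f \in edges G -> {within [set` third j], continuous (g f)}%classic.
    by move=> /arcs[cf _]; apply: continuous_subspaceW cf.
  have [|r r0 Hr] := disjoint_far (cts e i eG) (cts e' i' e'G).
    by move=> s t si ti; apply: (thirds_disjoint eG e'G nm).
  by exists r => // _ _ _; exact: Hr.
by exists eta => // e i e' i' s t eG e'G nm; apply: (H ((e, i), (e', i'))).
Qed.

Lemma arcs_uniform e0 : 0 < e0 -> exists2 r, 0 < r & forall e s s',
  e \in edges G -> s \in `[0, 1] -> s' \in `[0, 1] -> `|s - s'| < r ->
  sup_close e0 (g e s) (g e s').
Proof.
move=> e00; pose P (e : {set V}) r := e \in edges G -> forall s s',
  s \in `[0, 1] -> s' \in `[0, 1] -> `|s - s'| < r -> sup_close e0 (g e s) (g e s').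
have [e r r' r'r Pr eG s s' sI s'I ss'|e|r r0 H] := @finite_uniform R _ P.
- by apply: Pr => //; apply: lt_le_trans r'r.
- have [eG|eG] := boolP (e \in edges G); last by exists 1 => //; rewrite /P (negbTE eG).
  have [_ arcs _ _ _] := drawing.
  have [r r0 Hr] := uniform_close (arcs e eG).1 e00.
  by exists r => // _; exact: Hr.
by exists r => // e s s' eG; apply: H.
Qed.

End Drawing.

(** * Walks of cells along the arcs *)

Section Walks.
Variables (R : realType) (V : finType) (G : sgraph V).
Variables (p : V -> R * R) (g : {set V} -> R -> R * R) (src dst : {set V} -> V).
Hypothesis edgeE : {in edges G, forall e : {set V}, e = [set src e; dst e]}.
Hypothesis arc_src : {in edges G, forall e : {set V}, g e 0 = p (src e)}.
Hypothesis arc_dst : {in edges G, forall e : {set V}, g e 1 = p (dst e)}.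
Variables (eta : R) (m : nat).
Hypothesis eta0 : 0 < eta.
Hypothesis m0 : (0 < m)%N.
Hypothesis far : forall e i e' i' s t, e \in edges G -> e' \in edges G ->
  ~~ may_meet src dst e i e' i' -> s \in third R i -> t \in third R i' ->
  ~~ sup_close (eta + eta + eta) (g e s) (g e' t).
Hypothesis unif : forall e s s', e \in edges G -> s \in `[0, 1] -> s' \in `[0, 1] ->
  `|s - s'| <= (3 * m)%:R^-1 -> sup_close eta (g e s) (g e s').

Let own := owner src dst.
Let meet := may_meet src dst.

Definition time (k : nat) : R := k%:R / (3 * m)%:R.

Lemma time_third k (i : 'I_3) : (i * m <= k <= i.+1 * m)%N -> time k \in third R i.
Proof.
have m0' : 0 < m%:R :> R by rewrite ltr0n.
move=> /andP[h1 h2]; rewrite /third /time in_itv /=; apply/andP; split.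
  rewrite ler_pdivrMr // mulrAC ler_pdivlMr ?ltr0n ?muln_gt0 ?m0 //.
  by rewrite -!natrM ler_nat; lia.
rewrite ler_pdivlMr // mulrAC ler_pdivrMr ?ltr0n ?muln_gt0 ?m0 //.
by rewrite -!natrM ler_nat; lia.
Qed.

Lemma time_unit k : (k <= 3 * m)%N -> time k \in `[0, 1].
Proof.
move=> km; rewrite in_itv /= divr_ge0 //= ler_pdivrMr ?ltr0n ?muln_gt0 ?m0 //.
by rewrite mul1r ler_nat.
Qed.

Lemma time_step k k' : (k <= k' <= k.+1)%N -> `|time k' - time k| <= (3 * m)%:R^-1.
Proof.
move=> /andP[h1 h2]; rewrite -mulrBl normrM (@ger0_norm _ _^-1) ?invr_ge0 //.
rewrite -[leRHS]mul1r ler_wpM2r ?invr_ge0 // -natrB // normr_nat.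
by rewrite (ler_nat R _ 1); lia.
Qed.

(* The abscissa is updated at odd indices and the ordinate at even ones, so
   that consecutive cells are never diagonal neighbours. *)
Definition walk_pt e j : R * R := ((g e (time (uphalf j))).1, (g e (time j./2)).2).
Definition walk e j : cell := grid_cell eta (walk_pt e j).

Lemma half_le_uphalf j : (j./2 <= uphalf j <= j./2.+1)%N.
Proof. by rewrite uphalf_half; case: odd; lia. Qed.

Lemma walk_pt_close e j : e \in edges G -> (j <= 6 * m)%N ->
  sup_close eta (walk_pt e j) (g e (time j./2)).
Proof.
move=> eG j6; have hj := half_le_uphalf j.
have hu : (uphalf j <= 3 * m)%N by rewrite uphalf_half; lia.
have /andP[h1 _] : sup_close eta (g e (time (uphalf j))) (g e (time j./2)).
  by apply: unif => //; rewrite ?time_unit ?time_step //; lia.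
by rewrite /sup_close /= h1 subrr normr0.
Qed.

Lemma walk_adjacent e j : e \in edges G -> (j < 6 * m)%N ->
  adjacent (walk e j) (walk e j.+1).
Proof.
move=> eG j6; rewrite /walk /walk_pt /grid_cell /=.
have /andP[hx hy] : sup_close eta (g e (time (j./2).+1)) (g e (time j./2)).
  by apply: unif => //; rewrite ?time_unit ?time_step //; lia.
by rewrite uphalf_half; case: (odd j); [apply/adjacent_y|apply/adjacent_x];
  apply: close_floor.
Qed.

Definition on_third (i : 'I_3) (j : nat) := (i * (2 * m) <= j <= i.+1 * (2 * m))%N.

Lemma on_third_le i j : on_third i j -> (j <= 6 * m)%N.
Proof. by rewrite /on_third; case: i => /= i ?; nia. Qed.

Lemma on_third_ex j : (j <= 6 * m)%N -> exists i, on_third i j.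
Proof.
move=> j6; have [j2|j2] := leqP j (2 * m).
  by exists ord0; rewrite /on_third /=; lia.
have [j4|j4] := leqP j (4 * m).
  by exists (inord 1); rewrite /on_third /= inordK //; lia.
by exists (inord 2); rewrite /on_third /= inordK //; lia.
Qed.

(** The margin [eta] is spent three times: from each walk point to its arc, and across the common
    cell. *)
Lemma walk_meet e i j e' i' j' : e \in edges G -> e' \in edges G ->
  on_third i j -> on_third i' j' -> walk e j = walk e' j' -> meet e i e' i'.
Proof.
move=> eG e'G ij ij' ww; apply/negPn/negP => nm.
have [ti ti'] : time j./2 \in third R i /\ time j'./2 \in third R i'.
  by move: ij ij'; rewrite /on_third => h h'; split; apply: time_third; lia.
have /negP := far eG e'G nm ti ti'; apply.
apply: (sup_close_trans _ (walk_pt_close e'G (on_third_le ij'))).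
apply: (sup_close_trans _ (grid_cell_eq eta0 ww)).
by rewrite sup_close_sym walk_pt_close // (on_third_le ij).
Qed.

(** The cells met by the outer thirds at [v]; they hang together because each of these walks has the
    cell of [p v] as an end. *)
Definition core (v : V) (c : cell) := exists e i j,
  [/\ e \in edges G, own e i = Some v, on_third i j & c = walk e j].

Lemma core_disjoint v w c : core v c -> core w c -> v = w.
Proof.
move=> [e [i [j [eG ov ij ->]]]] [e' [i' [j' [e'G ow ij' ww]]]].
by have := walk_meet eG e'G ij ij' ww; rewrite /meet /may_meet -/(own e i)
   -/(own e' i') ov ow => /eqP.
Qed.

Lemma src_core e j : e \in edges G -> (j <= 2 * m)%N -> core (src e) (walk e j).
Proof. by move=> eG j2; exists e, ord0, j; split=> //; rewrite /on_third /=; lia. Qed.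

Lemma dst_core e j : e \in edges G -> (4 * m <= j <= 6 * m)%N -> core (dst e) (walk e j).
Proof.
move=> eG j2; exists e, (inord 2), j; split=> //.
  by rewrite /own /owner inordK.
by rewrite /on_third /= inordK //; lia.
Qed.

(* The middle of an arc is attached to the core of its source, up to the first
   cell in the core of its target. *)
Lemma first_hit e : e \in edges G -> exists k, [/\ (0 < k <= 6 * m)%N,
  core (dst e) (walk e k) & forall j, (j < k)%N -> ~ core (dst e) (walk e j)].
Proof.
move=> eG; have ex : exists k, `[< core (dst e) (walk e k) >].
  by exists (6 * m)%N; apply/asboolP/dst_core => //; lia.
have [k /asboolP hk kmin] := ex_minnP ex.
exists k; split=> //; last first.
  by move=> j jk /asboolP/kmin; lia.
have k6 : (k <= 6 * m)%N by apply/kmin/asboolP/dst_core => //; lia.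
rewrite k6 andbT lt0n; apply/negP => /eqP k0; move: hk; rewrite k0.
move=> /(core_disjoint (src_core eG (leq0n _))) sd.
by have := @set2_edge_neq _ G (src e) (dst e); rewrite -edgeE // sd eqxx => /(_ eG).
Qed.

Section Regions.
Variable hit : {set V} -> nat.
Hypothesis hitP : forall e, e \in edges G -> [/\ (0 < hit e <= 6 * m)%N,
  core (dst e) (walk e (hit e)) & forall j, (j < hit e)%N -> ~ core (dst e) (walk e j)].

Definition region (v : V) (c : cell) := core v c \/
  exists e j, [/\ e \in edges G, src e = v, (j < hit e)%N & c = walk e j].

Lemma before_hit e j : e \in edges G -> (j < hit e)%N ->
  core (src e) (walk e j) \/ on_third (inord 1) j.
Proof.
move=> eG jk; have [k6 _ nocore] := hitP eG.
have [j2|j2] := leqP j (2 * m); first by left; apply: src_core.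
have [j4|j4] := leqP j (4 * m); first by right; rewrite /on_third inordK //; lia.
by case: (nocore j jk); apply: dst_core => //; lia.
Qed.

(** The middle third of [e] can only enter the core of an end of [e], and before the first hit this
    is not the target. *)
Lemma core_walk_disjoint v e j : e \in edges G -> (j < hit e)%N ->
  core v (walk e j) -> v = src e.
Proof.
move=> eG jk cv; have [/(core_disjoint cv)//|j1] := before_hit eG jk.
have [e' [i' [j' [e'G ov ij' ww]]]] := cv.
have := walk_meet eG e'G j1 ij' ww; rewrite /meet /may_meet -/(own e' i') ov.
rewrite {1}/owner inordK //= {1}(edgeE eG) !inE => /orP[/eqP//|/eqP vd].
by have [_ _ /(_ j jk)] := hitP eG; rewrite -vd.
Qed.

Lemma region_disjoint v w c : region v c -> region w c -> v = w.
Proof.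
move=> [cv|[e [j [eG <- jk ->]]]] [cw|[e' [j' [e'G <- jk' ww]]]].
- exact: core_disjoint cv cw.
- by apply: core_walk_disjoint e'G jk' _; rewrite -ww.
- by rewrite (core_walk_disjoint eG jk cw).
have [cv|j1] := before_hit eG jk.
  by apply: core_walk_disjoint e'G jk' _; rewrite -ww.
have [cw|j1'] := before_hit e'G jk'.
  by rewrite (core_walk_disjoint (v := src e') eG jk) // ww.
have := walk_meet eG e'G j1 j1' ww.
by rewrite /meet /may_meet /owner inordK //= => /eqP->.
Qed.

Definition label (c : cell) : option V :=
  if pselect (exists v, region v c) is left ex then Some (projT1 (cid ex)) else None.

Lemma labelE v c : (label c == Some v) = `[< region v c >].
Proof.
rewrite /label; case: pselect => [ex|nex]; last first.
  by apply/esym/asboolP => vc; apply: nex; exists v.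
have rx := projT2 (cid ex); apply/eqP/asboolP => [[<-]//|vc].
by rewrite (region_disjoint rx vc).
Qed.

Lemma label_bound : exists K : nat,
  forall c v, label c = Some v -> `|c.1| < K%:Z /\ `|c.2| < K%:Z.
Proof.
pose size e j := maxn `|(walk e j).1|%N `|(walk e j).2|%N.
exists (\max_(e : {set V}) \max_(j < (6 * m).+1) size e j).+1 => c v /eqP.
rewrite labelE => /asboolP vc.
have [e [j [j6 ->]]] : exists e j, (j <= 6 * m)%N /\ c = walk e j.
  case: vc => [[e [i [j [_ _ ij ->]]]]|[e [j [eG _ jk ->]]]]; exists e, j; split=> //.
    exact: on_third_le ij.
  by have [k6 _ _] := hitP eG; lia.
have := leq_bigmax e (F := fun e => \max_(j < (6 * m).+1) size e j).
have := leq_bigmax (Ordinal (j6 : (j < (6 * m).+1)%N)) (F := fun j : 'I__ => size e j).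
by rewrite /size /=; lia.
Qed.

Lemma linked_core v c : core v c ->
  linked (fun c => label c == Some v) (grid_cell eta (p v)) c.
Proof.
move=> [e [i [j [eG ov ij ->]]]]; have j6 := on_third_le ij.
move: ov ij; rewrite /own /owner /on_third.
have time0 : time 0 = 0 by rewrite /time mul0r.
have time1 : time (3 * m) = 1 by rewrite /time divff // pnatr_eq0; lia.
case: (ord3P i) => -> //= [<-] ij.
  have -> : grid_cell eta (p (src e)) = walk e 0.
    by rewrite /walk /walk_pt /= time0 arc_src //; case: (p _).
  apply: linked_walk => // k jk; first by apply: walk_adjacent => //; lia.
  by rewrite labelE; apply/asboolP; left; apply: src_core => //; lia.
have -> : grid_cell eta (p (dst e)) = walk e (6 * m).
  rewrite /walk /walk_pt.
  have [-> ->] : uphalf (6 * m) = (3 * m)%N /\ (6 * m)./2 = (3 * m)%N by rewrite uphalf_half; lia.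
  by rewrite time1 arc_dst //; case: (p _).
apply/linked_sym/linked_walk => // k jk; first by apply: walk_adjacent => //; lia.
by rewrite labelE; apply/asboolP; left; apply: dst_core => //; lia.
Qed.

(** The cell of the first hit and the one before it are adjacent with different labels, so a side
    separates them. It may face either way, hence the ends are listed in the order of [cellm] and
    [cellp]. *)
Lemma selected_side e : e \in edges G -> exists x : side * V * V,
  [/\ e = [set x.1.2; x.2], label (cellm x.1.1) = Some x.1.2, label (cellp x.1.1) = Some x.2,
    linked (fun c => label c == Some x.1.2) (grid_cell eta (p x.1.2)) (cellm x.1.1) &
    linked (fun c => label c == Some x.2) (grid_cell eta (p x.2)) (cellp x.1.1)].
Proof.
move=> eG; have [k6 corek nocore] := hitP eG; set k := hit e in k6 corek nocore.
have reg j : (j < k)%N -> label (walk e j) = Some (src e).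
  by move=> jk; apply/eqP; rewrite labelE; apply/asboolP; right; exists e, j.
have regk : label (walk e k) = Some (dst e).
  by apply/eqP; rewrite labelE; apply/asboolP; left.
have lk1 : linked (fun c => label c == Some (src e)) (grid_cell eta (p (src e))) (walk e k.-1).
  apply: linked_trans (linked_core (src_core eG (leq0n _))) _.
  apply: linked_walk => // j jk; first by apply: walk_adjacent => //; lia.
  by rewrite reg //; lia.
have lk2 := linked_core corek.
have srcdst : src e != dst e by apply: (@set2_edge_neq _ G); rewrite -edgeE.
have k1 : label (walk e k.-1) = Some (src e) by apply: reg; lia.
have : adjacent (walk e k.-1) (walk e k.-1.+1) by apply: walk_adjacent => //; lia.
have -> : k.-1.+1 = k by lia.
case=> [eqw|[d [] [em ep]]].
- by move: srcdst regk; rewrite -eqw k1 => /eqP ne [].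
- by exists (d, src e, dst e); rewrite /= -em -ep -edgeE.
by exists (d, dst e, src e); rewrite /= -em -ep finset.setUC -edgeE.
Qed.

End Regions.

Theorem walks_dual : has_dual G.
Proof.
have /choice[hit hitP] : forall e, exists k, e \in edges G -> [/\ (0 < k <= 6 * m)%N,
    core (dst e) (walk e k) & forall j, (j < k)%N -> ~ core (dst e) (walk e j)].
  move=> e; have [eG|_] := boolP (e \in edges G); last by exists 0%N.
  by have [k kP] := first_hit eG; exists k.
have [K lab_bound] := label_bound hitP.
have [E0|[e0 e0G]] := set_0Vmem (edges G).
  exists unit, (fun=> tt), (fun=> tt); split=> [f|X XG _].
    by apply/forallP => v; rewrite /odd_deg big1 // => e _; rewrite inE E0 inE.
  by exists xpredT => e; rewrite E0 inE.
have [x0 _] := selected_side hitP e0G.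
have /choice[x xP] : forall e, exists x : side * V * V, e \in edges G ->
  [/\ e = [set x.1.2; x.2], label hit (cellm x.1.1) = Some x.1.2,
    label hit (cellp x.1.1) = Some x.2,
    linked (fun c => label hit c == Some x.1.2) (grid_cell eta (p x.1.2)) (cellm x.1.1) &
    linked (fun c => label hit c == Some x.2) (grid_cell eta (p x.2)) (cellp x.1.1)].
  move=> e; have [eG|_] := boolP (e \in edges G); last by exists x0.
  by have [x xP] := selected_side hitP eG; exists x.
apply: (@grid_dual V G (label hit) K lab_bound (fun v => grid_cell eta (p v))
  (fun e => (x e).1.1) (fun e => (x e).1.2) (fun e => (x e).2)) => e /xP[] //.
Qed.

End Walks.

Theorem planar_dual (R : realType) (V : finType) (G : sgraph V) : planar R G ->
  has_dual G.
Proof.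
move=> [p [g drawing]]; have [_ _ ends _ _] := drawing.
have [E0|[e0 e0G]] := set_0Vmem (edges G).
  exists unit, (fun=> tt), (fun=> tt); split=> [f|X XG _].
    by apply/forallP => v; rewrite /odd_deg big1 // => e _; rewrite inE E0 inE.
  by exists xpredT => e; rewrite E0 inE.
have [x0 _] := ends e0 e0G.
have /choice[x xP] : forall e, exists x : V * V, e \in edges G ->
    [/\ e = [set x.1; x.2], g e 0 = p x.1 & g e 1 = p x.2].
  move=> e; have [eG|_] := boolP (e \in edges G); last by exists (x0, x0).
  by have [a [b ?]] := ends e eG; exists (a, b).
pose src e := (x e).1; pose dst e := (x e).2.
have edgeE : {in edges G, forall e : {set V}, e = [set src e; dst e]} by move=> e /xP[].
have arc_src : {in edges G, forall e : {set V}, g e 0 = p (src e)} by move=> e /xP[].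
have arc_dst : {in edges G, forall e : {set V}, g e 1 = p (dst e)} by move=> e /xP[].
have [eta eta0 far] := thirds_far drawing edgeE arc_src arc_dst.
have eta3 : 0 < eta / 3 by rewrite divr_gt0.
have [r r0 unif] := arcs_uniform drawing eta3.
(* Makes the time step [1 / (3 * m)] smaller than the modulus of continuity [r]. *)
pose m := (Num.bound r^-1).+1.
have mr : (3 * m)%:R^-1 < r.
  rewrite invf_plt ?posrE ?ltr0n ?muln_gt0 //.
  apply: lt_le_trans (archi_boundP _) _; first by rewrite invr_ge0 ltW.
  by rewrite ler_nat /m mulnS; apply: leq_trans (leq_pmull _ _) (leq_addl _ _).
apply: (@walks_dual R V G p g src dst edgeE arc_src arc_dst (eta / 3) m eta3) => //.
  move=> e i e' i' s t eG e'G nm si ti.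
  have -> : eta / 3 + eta / 3 + eta / 3 = eta by lra.
  exact: far nm si ti.
by move=> e s s' eG sI s'I ss'; apply: unif => //; apply: le_lt_trans mr.
Qed.

(** * Nested cuboctahedra *)

(* Vertices [0..3], [4..7], [8..11] are the squares of a cuboctahedron, [12..19] is
   the ring of eight, and [20..23] is the first square of the next block. *)
Definition block_edges : seq (nat * nat) := [::
  (0, 1); (1, 2); (2, 3); (0, 3);
  (0, 4); (1, 4); (1, 5); (2, 5); (2, 6); (3, 6); (3, 7); (0, 7);
  (4, 8); (4, 9); (5, 9); (5, 10); (6, 10); (6, 11); (7, 11); (7, 8);
  (8, 9); (9, 10); (10, 11); (8, 11);
  (8, 12); (8, 13); (9, 14); (9, 15); (10, 16); (10, 17); (11, 18); (11, 19);
  (12, 13); (13, 14); (14, 15); (15, 16); (16, 17); (17, 18); (18, 19); (12, 19);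
  (13, 20); (14, 20); (15, 21); (16, 21); (17, 22); (18, 22); (19, 23); (12, 23)]%N.

(** The last four points are the first four multiplied by 6 + 6i. *)
Definition block_points : seq (int * int) := [::
  (2, 0); (0, 2); (-2, 0); (0, -2);
  (3, 3); (-3, 3); (-3, -3); (3, -3);
  (8, 0); (0, 8); (-8, 0); (0, -8);
  (11, -2); (11, 2); (2, 11); (-2, 11); (-11, 2); (-11, -2); (-2, -11); (2, -11);
  (12, 12); (-12, 12); (-12, -12); (12, -12)].

Definition orient (T : pzRingType) (A B C : T * T) : T :=
  (B.1 - A.1) * (C.2 - A.2) - (B.2 - A.2) * (C.1 - A.1).

(** [C] and [D] lie in one closed half-plane of the line [AB], not both on the line, so the open
    segment [CD] misses it. *)
Definition one_side (T : numDomainType) (A B C D : T * T) :=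
  let o := orient A B C in let o' := orient A B D in
  [&& 0 <= o, 0 <= o' & 0 < o + o'] || [&& o <= 0, o' <= 0 & o + o' < 0].

Definition progress (T : pzRingType) (A B C : T * T) : T :=
  (B.1 - A.1) * (C.1 - A.1) + (B.2 - A.2) * (C.2 - A.2).

Definition off_segment (T : numDomainType) (A B C : T * T) :=
  [|| orient A B C != 0, progress A B C <= 0 | progress A B B <= progress A B C].

Definition block_pt (j : nat) : int * int := nth (0, 0) block_points j.

(** For [u] with coordinates 1 or -1, this keeps the segment in [|x| + |y| >= 2]. *)
Definition outer_normal (u : int * int) (A B : int * int) :=
  (2 <= u.1 * A.1 + u.2 * A.2) && (2 <= u.1 * B.1 + u.2 * B.2).

Lemma block_edges_uncrossed : all (fun e => all (fun e' => (e == e') ||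
  one_side (block_pt e.1) (block_pt e.2) (block_pt e'.1) (block_pt e'.2) ||
  one_side (block_pt e'.1) (block_pt e'.2) (block_pt e.1) (block_pt e.2))
  block_edges) block_edges.
Proof. by vm_compute. Qed.

Lemma block_edges_off_points : all (fun e => all (fun j =>
  off_segment (block_pt e.1) (block_pt e.2) (block_pt j)) (iota 0 20)) block_edges.
Proof. by vm_compute. Qed.

Lemma block_edges_outside : all (fun e => has (fun u =>
  outer_normal u (block_pt e.1) (block_pt e.2))
  [:: (1, 1); (1, -1); (-1, 1); (-1, -1)]) block_edges.
Proof. by vm_compute. Qed.

Definition block_nbrs (j : nat) : seq nat :=
  [seq (20 + e.2)%N | e <- block_edges & e.1 == j] ++
  [seq (20 + e.1)%N | e <- block_edges & e.2 == j] ++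
  [seq e.1 | e <- block_edges & e.2 == (20 + j)%N].

(* Neighbours are stored with a shift of one block, since those of the first
   four vertices of a block may lie in the previous block. *)
Lemma block_nbrs_apex : all (fun j => all (fun m => all (fun m1 => all (fun m2 =>
  ((20 + m1)%N \in [seq (20 * (m %/ 20) + m')%N | m' <- block_nbrs (m %% 20)]) ==>
  ((20 + m2)%N \in [seq (20 * (m %/ 20) + m')%N | m' <- block_nbrs (m %% 20)]) ==>
  (m1 == m2)) (block_nbrs j)) (block_nbrs j)) (block_nbrs j)) (iota 0 20).
Proof. by vm_compute. Qed.

Lemma block_edges_bound :
  all (fun e : nat * nat => [&& e.1 < e.2, e.1 < 20 & e.2 < 24]%N) block_edges.
Proof. by []. Qed.

(** * The extremal graph: [k] full blocks followed by one cuboctahedron *)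

Section RingGraph.
Variable k : nat.

Local Notation vertex := 'I_(20 * k + 11).+1.
Local Notation edge_index := 'I_(48 * k + 24).

Definition low (i : nat) : nat := (20 * (i %/ 48) + (nth (0, 0) block_edges (i %% 48)).1)%N.
Definition high (i : nat) : nat := (20 * (i %/ 48) + (nth (0, 0) block_edges (i %% 48)).2)%N.

Lemma nth_block_edge i : nth (0, 0)%N block_edges (i %% 48) \in block_edges.
Proof. by rewrite mem_nth // ltn_mod. Qed.

Lemma block_edge_bound e : e \in block_edges -> [&& e.1 < e.2, e.1 < 20 & e.2 < 24]%N.
Proof. by move: e; apply/allP/block_edges_bound. Qed.

Lemma low_high (i : nat) : (low i < high i)%N.
Proof. by have /and3P[h _ _] := block_edge_bound (nth_block_edge i); rewrite ltn_add2l. Qed.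

Lemma high_bound (i : edge_index) : (high i < (20 * k + 11).+1)%N.
Proof.
rewrite /high; have ik := ltn_ord i.
(* The last block is cut to its first 24 edges, which only use its vertices 0 to 11. *)
have b12 : (i %% 48 < 24)%N -> ((nth (0, 0) block_edges (i %% 48)).2 < 12)%N.
  have : all (fun e : nat * nat => (e.2 < 12)%N) (take 24 block_edges) by [].
  by move=> /(all_nthP (0, 0)%N)/(_ (i %% 48)%N) h r24; have := h r24; rewrite nth_take.
have /and3P[_ _] := block_edge_bound (nth_block_edge i).
move: (nth _ _ _).2 b12 => b b12 b24.
have [ilt|ige] := ltnP (i %/ 48) k; first by lia.
have r24 : (i %% 48 < 24)%N by lia.
by have := b12 r24; lia.
Qed.

Lemma low_bound (i : edge_index) : (low i < (20 * k + 11).+1)%N.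
Proof. exact: ltn_trans (low_high i) (high_bound i). Qed.

Definition ring_edge (i : edge_index) : {set vertex} :=
  [set Ordinal (low_bound i); Ordinal (high_bound i)].

Lemma ring_edges_card2 : [forall e in [set ring_edge i | i : edge_index], #|e| == 2].
Proof.
apply/forall_inP => _ /imsetP[i _ ->]; rewrite cards2 -val_eqE /=.
by rewrite neq_ltn low_high.
Qed.

Definition ring_graph := SGraph ring_edges_card2.

Lemma ring_edge_eq (i j : edge_index) : ring_edge i = ring_edge j ->
  low i = low j /\ high i = high j.
Proof.
move=> /eqP; rewrite set2_eq -!val_eqE /= => /orP[]/andP[/eqP h1 /eqP h2] //.
by have := low_high i; have := low_high j; lia.
Qed.

Lemma ring_edge_inj : injective ring_edge.
Proof.
move=> i j /ring_edge_eq[]; rewrite /low /high.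
have := block_edge_bound (nth_block_edge i); have := block_edge_bound (nth_block_edge j).
have : uniq block_edges by [].
move=> /(uniqP (0, 0)%N)/(_ (i %% 48)%N (j %% 48)%N); rewrite !inE !ltn_mod => /(_ isT isT).
case: (nth _ _ (i %% 48)) => a b; case: (nth _ _ (j %% 48)) => a' b' /= eq hb hb' h1 h2.
apply/val_inj => /=; have ij : (i %/ 48 = j %/ 48)%N by lia.
have /eq : (a, b) = (a', b') by congr (_, _); lia.
by move=> r; rewrite (divn_eq i 48) ij r -divn_eq.
Qed.

Lemma card_ring_edges : #|edges ring_graph| = (48 * k + 24)%N.
Proof. by rewrite /= card_imset ?card_ord //; apply: ring_edge_inj. Qed.

Lemma ring_nbrs (u v : vertex) : [set u; v] \in edges ring_graph ->
  exists2 m, m \in block_nbrs (u %% 20) & (v + 20 = 20 * (u %/ 20) + m)%N.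
Proof.
move=> /imsetP[i _ /eqP]; rewrite set2_eq -!val_eqE /= /low /high.
have eB := nth_block_edge i; have := block_edge_bound eB.
move: (nth _ _ _) eB => [a b] /= eB /and3P[ab a20 b24].
(* Three cases: [u] is the lower end, or the upper end within the same block, or the upper end lying
   in the next block. *)
move=> /orP[]/andP[/eqP uE /eqP vE].
  exists (20 + b)%N; last by lia.
  rewrite mem_cat; apply/orP; left; apply/mapP; exists (a, b) => //.
  by rewrite mem_filter eB andbT /=; lia.
have [b20|b20] := ltnP b 20.
  exists (20 + a)%N; last by lia.
  rewrite !mem_cat; apply/orP; right; apply/orP; left; apply/mapP; exists (a, b) => //.
  by rewrite mem_filter eB andbT /=; lia.
exists a; last by lia.
rewrite !mem_cat; apply/orP; right; apply/orP; right; apply/mapP; exists (a, b) => //.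
by rewrite mem_filter eB andbT /=; lia.
Qed.

Lemma ring_apex (u v s t : vertex) : [set u; v] \in edges ring_graph ->
  [set u; s] \in edges ring_graph -> [set u; t] \in edges ring_graph ->
  [set v; s] \in edges ring_graph -> [set v; t] \in edges ring_graph -> s = t.
Proof.
move=> /ring_nbrs[m mu vE] /ring_nbrs[m1 m1u sE] /ring_nbrs[m2 m2u tE].
move=> /ring_nbrs[m1' m1v sE'] /ring_nbrs[m2' m2v tE'].
have /allP/(_ (u %% 20)%N) := block_nbrs_apex; rewrite mem_iota ltn_mod => /(_ isT).
move=> /allP/(_ m mu)/allP/(_ m1 m1u)/allP/(_ m2 m2u).
have vm : (v %% 20 = m %% 20)%N by lia.
have vd : (v %/ 20 + 1 = u %/ 20 + m %/ 20)%N by lia.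
rewrite vm in m1v m2v.
have -> : (20 + m1)%N \in [seq (20 * (m %/ 20) + m')%N | m' <- block_nbrs (m %% 20)].
  by apply/mapP; exists m1' => //; lia.
have -> /= : (20 + m2)%N \in [seq (20 * (m %/ 20) + m')%N | m' <- block_nbrs (m %% 20)].
  by apply/mapP; exists m2' => //; lia.
by move=> /eqP m12; apply/val_inj => /=; lia.
Qed.

End RingGraph.

(** In a copy of a Theta graph on 4 vertices, the two vertices off the chord are both apices of
    triangles on it. *)
Lemma apex_theta4_free (V : finType) (G : sgraph V) :
  (forall u v s t : V, [set u; v] \in edges G -> [set u; s] \in edges G ->
    [set u; t] \in edges G -> [set v; s] \in edges G -> [set v; t] \in edges G -> s = t) ->
  Defs.free (Theta 4) G.
Proof.
move=> apex W H [_ [c c_bij [x [y [xy xyc HE]]]]] [f f_inj fH].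
have [c' cK c'K] := c_bij.
pose w (i : nat) := f (c (inord i)).
have cyc (i j : 'I_4) : j = ordS i -> [set f (c i); f (c j)] \in edges G.
  move=> ->; have := fH [set c i; c (ordS i)]; rewrite imsetU1 imset_set1; apply.
  by rewrite HE inE; apply/orP; right; apply/imsetP; exists i.
have e01 : [set w 0; w 1] \in edges G by apply: cyc; apply/val_inj; rewrite /= !inordK.
have e12 : [set w 1; w 2] \in edges G by apply: cyc; apply/val_inj; rewrite /= !inordK.
have e23 : [set w 2; w 3] \in edges G by apply: cyc; apply/val_inj; rewrite /= !inordK.
have e30 : [set w 3; w 0] \in edges G by apply: cyc; apply/val_inj; rewrite /= !inordK.
have exy : [set f x; f y] \in edges G.
  by have := fH [set x; y]; rewrite imsetU1 imset_set1; apply; rewrite HE !inE eqxx.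
have w_inj i j : (i < 4)%N -> (j < 4)%N -> w i = w j -> i = j.
  by move=> i4 j4 /f_inj/(bij_inj c_bij)/(congr1 val); rewrite /= !inordK.
(* The chord is no edge of the cycle, so it is one of the two diagonals. *)
have chord : [set w 0; w 2] \in edges G \/ [set w 1; w 3] \in edges G.
  have nadj (i j : 'I_4) : x = c i -> y = c j -> (j != ordS i) && (i != ordS j).
    move=> xi yj; apply/andP; split; apply: contraNneq xyc => E; apply/imsetP.
      by exists i; rewrite // xi yj E.
    by exists j; rewrite // xi yj E finset.setUC.
  have wE (i : 'I_4) : f (c i) = w i by rewrite /w inord_val.
  have := nadj (c' x) (c' y); rewrite !c'K => /(_ erefl erefl).
  have : c' x != c' y by rewrite (can_eq c'K).
  have fE z : f z = w (c' z) by rewrite -wE c'K.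
  move: exy; rewrite !fE -!val_eqE /=.
  move: (c' x) (c' y) => [[|[|[|[|//]]]] ?] [[|[|[|[|//]]]] ?] //= exy' _ _; auto;
    by rewrite finset.setUC in exy'; auto.
case: chord => ch.
  have := @apex (w 0) (w 2) (w 1) (w 3).
  by rewrite ![[set w 2; w 1]]finset.setUC ![[set w 0; w 3]]finset.setUC =>
    /(_ ch e01 e30 e12 e23)/w_inj => /(_ isT isT).
have := @apex (w 1) (w 3) (w 0) (w 2).
by rewrite ![[set w 1; w 0]]finset.setUC ![[set w 3; w 2]]finset.setUC =>
  /(_ ch e01 e12 e30 e23)/w_inj => /(_ isT isT).
Qed.

Lemma block_edges_proper :
  all (fun e => 0 < progress (block_pt e.1) (block_pt e.2) (block_pt e.2)) block_edges.
Proof. by vm_compute. Qed.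

Lemma block_points_outside : all (fun j => 2 <= `|(block_pt j).1| + `|(block_pt j).2|) (iota 0 24).
Proof. by vm_compute. Qed.

Lemma block_points_inside :
  all (fun j => (`|(block_pt j).1| < 12) && (`|(block_pt j).2| < 12)) (iota 0 20).
Proof. by vm_compute. Qed.

Lemma block_points_inside_le :
  all (fun j => (`|(block_pt j).1| <= 12) && (`|(block_pt j).2| <= 12)) (iota 0 24).
Proof. by vm_compute. Qed.

Lemma block_points_uniq : uniq (take 20 block_points).
Proof. by vm_compute. Qed.

(** * The straight-line drawing, periodic under [twist] *)

Section RingDrawing.
Variable R : realType.
Implicit Types (z A B C D : R * R) (s t : R).

Definition real_pt (u : int * int) : R * R := (u.1%:~R, u.2%:~R).

(* Multiplication by [6 + 6i], which carries each ring to the next one. *)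
Definition twist z : R * R := (6 * (z.1 - z.2), 6 * (z.1 + z.2)).

Definition chord A B t : R * R := (A.1 + t * (B.1 - A.1), A.2 + t * (B.2 - A.2)).

Lemma twist_inj : injective twist.
Proof. by move=> [x y] [x' y'] [] /= h1 h2; congr (_, _); lra. Qed.

Lemma iter_twist_inj q : injective (iter q twist).
Proof. by elim: q => [|q IH] z z' //= /twist_inj/IH. Qed.

Lemma iter_twist_chord q A B t :
  iter q twist (chord A B t) = chord (iter q twist A) (iter q twist B) t.
Proof.
elim: q => //= q ->; rewrite /twist /chord /=; congr (_, _); ring.
Qed.

Lemma real_pt_twist j : (j < 4)%N -> real_pt (block_pt (20 + j)) = twist (real_pt (block_pt j)).
Proof.
by case: j => [|[|[|[|//]]]] _; rewrite /real_pt /twist /=; congr (_, _); lra.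
Qed.

(** A fundamental domain of [twist]: the outer square is the image of the inner one,
    [|x| + |y| = 2]. *)
Definition ring_region z := [&& 2 <= `|z.1| + `|z.2|, `|z.1| < 12 & `|z.2| < 12].

(** Since [|x| + |y|] is the larger of [|x - y|] and [|x + y|], one [twist] brings a point with
    [|x| + |y| >= 2] to sup norm at least 12. *)
Lemma iter_twist_far q z : 2 <= `|z.1| + `|z.2| ->
  2 <= `|(iter q twist z).1| + `|(iter q twist z).2| /\
  ((0 < q)%N -> (12 <= `|(iter q twist z).1|) || (12 <= `|(iter q twist z).2|)).
Proof.
move=> z2; elim: q => [|q [IH _]]; first by split.
suff h : (12 <= `|(iter q.+1 twist z).1|) || (12 <= `|(iter q.+1 twist z).2|).
  split=> //; apply: le_trans (_ : 12 <= _); first by rewrite ler_nat.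
  case/orP: h => h.
    by apply: le_trans h _; rewrite lerDl.
  by apply: le_trans h _; rewrite lerDr.
move: IH; rewrite iterS; move: (iter q twist z) => [x y] /= h.
rewrite !normrM (ger0_norm (_ : 0 <= 6)) //.
have : `|x| + `|y| <= `|x - y| \/ `|x| + `|y| <= `|x + y|.
  have [x0|x0] := lerP 0 x; have [y0|y0] := lerP 0 y.
  - by right; rewrite (ger0_norm x0) (ger0_norm y0) ler_norm.
  - by left; rewrite (ger0_norm x0) (ltr0_norm y0) ler_norm.
  - by left; rewrite (ltr0_norm x0) (ger0_norm y0) distrC addrC ler_norm.
  - by right; rewrite (ltr0_norm x0) (ltr0_norm y0) -normrN opprD ler_norm.
by case=> h'; apply/orP; [left|right]; lra.
Qed.

Lemma ring_region_inj q q' z z' : ring_region z -> ring_region z' ->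
  iter q twist z = iter q' twist z' -> q = q' /\ z = z'.
Proof.
wlog qq' : q q' z z' / (q <= q')%N.
  move=> H rz rz' E; have [/H|/ltnW/H] := leqP q q'; first by apply.
  by move=> /(_ z' z rz' rz (esym E))[-> ->].
move=> /and3P[z1 z2 z3] /and3P[z1' _ _].
rewrite -(subnKC qq') iterD => /iter_twist_inj zE.
have [d0|d0] := posnP (q' - q); first by rewrite zE d0 addn0.
have [_ /(_ d0)] := iter_twist_far (q' - q) z1'.
by rewrite -zE => /orP[]; rewrite leNgt ?z2 ?z3.
Qed.

Lemma orient_chord A B C D t :
  orient A B (chord C D t) = (1 - t) * orient A B C + t * orient A B D.
Proof. by rewrite /orient /chord /=; ring. Qed.

Lemma orient_chord0 A B t : orient A B (chord A B t) = 0.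
Proof. by rewrite /orient /chord /=; ring. Qed.

Lemma convex_gt0 (a b t : R) : 0 <= a -> 0 <= b -> 0 < a + b -> 0 < t -> t < 1 ->
  0 < (1 - t) * a + t * b.
Proof.
move=> a0 b0 ab t0 t1; have t1' : 0 < 1 - t by rewrite subr_gt0.
have [a1|a1] := ltP 0 a.
  by apply: ltr_wpDr; [apply: mulr_ge0 => //; apply: ltW | apply: mulr_gt0].
have b1 : 0 < b by lra.
by apply: ltr_wpDl; [apply: mulr_ge0 => //; apply: ltW | apply: mulr_gt0].
Qed.

(** The orientation relative to [AB] is affine along [CD] and nonzero inside it, whereas it vanishes
    on the line [AB]. *)
Lemma one_side_chord A B C D s t : one_side A B C D -> t \in `]0, 1[ ->
  chord A B s <> chord C D t.
Proof.
rewrite in_itv /= => h /andP[t0 t1] E.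
have := orient_chord A B C D t; rewrite -E orient_chord0.
move: h; rewrite /one_side; set o := orient _ _ C; set o' := orient _ _ D.
case/orP => /and3P[h1 h2 h3] oE.
  by have := convex_gt0 h1 h2 h3 t0 t1; lra.
by have := @convex_gt0 (- o) (- o') t; rewrite !oppr_ge0 => /(_ h1 h2); lra.
Qed.

Lemma progress_chord A B t : progress A B (chord A B t) = t * progress A B B.
Proof. by rewrite /progress /chord /=; ring. Qed.

Lemma off_segment_chord A B C t : 0 < progress A B B -> off_segment A B C ->
  t \in `]0, 1[ -> chord A B t <> C.
Proof.
rewrite in_itv /= => h /or3P[] h1 /andP[t0 t1] E; move: h1; rewrite -E.
- by rewrite orient_chord0 eqxx.
- by rewrite progress_chord; nra.
- by rewrite progress_chord; nra.
Qed.

Lemma chord_inj A B : 0 < progress A B B -> injective (chord A B).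
Proof.
move=> h s t /(congr1 (progress A B)); rewrite !progress_chord.
by apply/mulIf/lt0r_neq0.
Qed.

Lemma real_orient (u v w : int * int) :
  orient (real_pt u) (real_pt v) (real_pt w) = (orient u v w)%:~R.
Proof. by rewrite /orient /= !(intrB, intrM). Qed.

Lemma real_progress (u v w : int * int) :
  progress (real_pt u) (real_pt v) (real_pt w) = (progress u v w)%:~R.
Proof. by rewrite /progress /= !(intrB, intrM, intrD). Qed.

Lemma real_one_side (u v w x : int * int) :
  one_side u v w x -> one_side (real_pt u) (real_pt v) (real_pt w) (real_pt x).
Proof. by rewrite /one_side !real_orient -intrD !ler0z !lerz0 ltr0z ltrz0. Qed.

Lemma real_off_segment (u v w : int * int) :
  off_segment u v w -> off_segment (real_pt u) (real_pt v) (real_pt w).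
Proof. by rewrite /off_segment real_orient !real_progress intr_eq0 lerz0 ler_int. Qed.

Definition block_chord (e : nat * nat) := chord (real_pt (block_pt e.1)) (real_pt (block_pt e.2)).

Lemma block_progress e : e \in block_edges ->
  0 < progress (real_pt (block_pt e.1)) (real_pt (block_pt e.2)) (real_pt (block_pt e.2)).
Proof. by move=> eB; rewrite real_progress ltr0z; apply: (allP block_edges_proper). Qed.

(** Equality is allowed for [y] because the upper end of an edge may be a vertex of the next block,
    on the outer square. *)
Lemma convex_lt12 (x y t : R) : `|x| < 12 -> `|y| <= 12 -> 0 < t -> t < 1 ->
  `|x + t * (y - x)| < 12.
Proof.
by rewrite !ltr_norml ler_norml => /andP[? ?] /andP[? ?] ? ?; apply/andP; split; nra.
Qed.

Lemma chord_region A B (a b t : R) : `|A.1| < 12 -> `|A.2| < 12 ->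
  `|B.1| <= 12 -> `|B.2| <= 12 -> `|a| <= 1 -> `|b| <= 1 ->
  2 <= a * A.1 + b * A.2 -> 2 <= a * B.1 + b * B.2 -> 0 < t -> t < 1 ->
  ring_region (chord A B t).
Proof.
move=> A1 A2 B1 B2 a1 b1 uA uB t0 t1.
rewrite /ring_region /chord /= !convex_lt12 // !andbT.
set X := A.1 + _; set Y := A.2 + _.
have h : 2 <= a * X + b * Y.
  have -> : a * X + b * Y = (1 - t) * (a * A.1 + b * A.2) + t * (a * B.1 + b * B.2).
    by rewrite /X /Y; ring.
  by move: uA uB; set c := _ + _; set d := _ + _; nra.
apply: le_trans h _; apply: lerD; apply: le_trans (ler_norm _) _; rewrite normrM.
  by rewrite ler_piMl.
by rewrite ler_piMl.
Qed.

Lemma block_chord_region e t : e \in block_edges -> t \in `]0, 1[ ->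
  ring_region (block_chord e t).
Proof.
move=> eB; rewrite in_itv /= => /andP[t0 t1].
have /and3P[_ e20 e24] := block_edge_bound eB.
have /(_ e.1) := allP block_points_inside; rewrite mem_iota => /(_ e20)/andP[a1 a2].
have /(_ e.2) := allP block_points_inside_le; rewrite mem_iota => /(_ e24)/andP[b1 b2].
have /hasP[u uin /andP[ua ub]] := allP block_edges_outside e eB.
have [u1 u2] : `|u.1| <= 1 /\ `|u.2| <= 1 by move: uin; rewrite !inE => /or4P[]/eqP->.
apply: (@chord_region _ _ u.1%:~R u.2%:~R) => //=; rewrite -?intr_norm -?intrM -?intrD.
- by rewrite (ltr_int _ _ 12).
- by rewrite (ltr_int _ _ 12).
- by rewrite (ler_int _ _ 12).
- by rewrite (ler_int _ _ 12).
- by rewrite (ler_int _ _ 1).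
- by rewrite (ler_int _ _ 1).
- by rewrite (ler_int _ 2).
- by rewrite (ler_int _ 2).
Qed.

Lemma block_chords_disjoint e e' s t : e \in block_edges -> e' \in block_edges -> e != e' ->
  s \in `]0, 1[ -> t \in `]0, 1[ -> block_chord e s <> block_chord e' t.
Proof.
move=> eB e'B ee' sI tI.
have := allP (allP block_edges_uncrossed e eB) e' e'B; rewrite (negbTE ee') /=.
case/orP => /real_one_side h; first exact: one_side_chord h tI.
by move=> E; apply: (one_side_chord h sI (esym E)).
Qed.

Lemma block_chord_off_points e j t : e \in block_edges -> (j < 20)%N -> t \in `]0, 1[ ->
  block_chord e t <> real_pt (block_pt j).
Proof.
move=> eB j20 tI; apply: off_segment_chord (block_progress eB) _ tI.
apply: real_off_segment; apply: (allP (allP block_edges_off_points e eB)).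
by rewrite mem_iota.
Qed.

Definition vertex_pt (v : nat) := iter (v %/ 20) twist (real_pt (block_pt (v %% 20))).

(** Points 20 to 23 of a block are the first four of the next one, and both readings give the same
    point. *)
Lemma vertex_pt_block q j : (j < 24)%N ->
  vertex_pt (20 * q + j) = iter q twist (real_pt (block_pt j)).
Proof.
move=> j24; rewrite /vertex_pt mulnC divnMDl // modnMDl.
have [j20|j20] := ltnP j 20; first by rewrite divn_small // modn_small // addn0.
have [-> ->] : (j %/ 20 = 1)%N /\ (j %% 20 = j - 20)%N by lia.
by rewrite addn1 iterSr -real_pt_twist ?subnKC //; lia.
Qed.

Lemma block_pt_region j : (j < 20)%N -> ring_region (real_pt (block_pt j)).
Proof.
move=> j20; have /(_ j) := allP block_points_inside; rewrite mem_iota => /(_ j20)/andP[h1 h2].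
have /(_ j) := allP block_points_outside; rewrite mem_iota => /(_ (ltn_trans j20 _))h3.
rewrite /ring_region /real_pt /= -!intr_norm -intrD.
by rewrite (ler_int _ 2) !(ltr_int _ _ 12) h1 h2 h3.
Qed.

Lemma vertex_pt_inj : injective vertex_pt.
Proof.
move=> u v /ring_region_inj[]; rewrite ?block_pt_region ?ltn_mod // => uv [].
move=> /intr_inj h1 /intr_inj h2.
suff r : (u %% 20 = v %% 20)%N by rewrite (divn_eq u 20) uv r -divn_eq.
have := block_points_uniq; move=> /(uniqP (0, 0))/(_ (u %% 20)%N (v %% 20)%N).
rewrite !inE !ltn_mod !nth_take ?ltn_mod // => /(_ isT isT); apply.
by apply/eqP; rewrite -pair_eqE /pair_eq /= h1 h2 !eqxx.
Qed.

Variable k : nat.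
Local Notation vertex := 'I_(20 * k + 11).+1.
Local Notation edge_index := 'I_(48 * k + 24).

Definition arc (i : nat) (t : R) := chord (vertex_pt (low i)) (vertex_pt (high i)) t.

Lemma arcE i t : arc i t =
  iter (i %/ 48) twist (block_chord (nth (0, 0)%N block_edges (i %% 48)) t).
Proof.
have /and3P[_ a20 b24] := block_edge_bound (nth_block_edge i).
rewrite /arc /low /high !vertex_pt_block ?iter_twist_chord //.
exact: leq_trans a20 _.
Qed.

Definition ring_arc (e : {set vertex}) : R -> R * R :=
  if [pick i : edge_index | ring_edge i == e] is Some i then arc i else fun=> 0.

Lemma ring_arcE e : e \in edges (ring_graph k) ->
  exists2 i : edge_index, e = ring_edge i & ring_arc e = arc i.
Proof.
move=> /imsetP[j _ eE]; rewrite /ring_arc; case: pickP => [i /eqP ei|noi].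
  by exists i.
by have := noi j; rewrite eE eqxx.
Qed.

Lemma chord_continuous A B : continuous (chord A B).
Proof.
move=> t; have affine (a b : R) : (a + s * (b - a) @[s --> t] --> a + t * (b - a))%classic.
  by apply: cvgD; [exact: cvg_cst|apply: cvgM; [exact: cvg_id|exact: cvg_cst]].
exact: cvg_pair (affine A.1 B.1) (affine A.2 B.2).
Qed.

(** Vertices and open arcs lie in twisted copies of [ring_region], so [ring_region_inj] brings any
    coincidence back to a single block, where it was excluded by computation. *)
Lemma ring_drawing :
  plane_drawing (ring_graph k) (fun v : vertex => vertex_pt v) ring_arc.
Proof.
split.
- by move=> u v /vertex_pt_inj/val_inj.
- move=> e /ring_arcE[i _ ->]; split.
    by apply: continuous_subspaceT; apply: chord_continuous.
  move=> s t _ _; rewrite !arcE => /iter_twist_inj.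
  by apply/chord_inj/block_progress/nth_block_edge.
- move=> e /ring_arcE[i -> ->].
  exists (Ordinal (low_bound i)), (Ordinal (high_bound i)); split=> //.
    by rewrite /arc /chord !mul0r !addr0; case: (vertex_pt _).
  rewrite /arc /chord !mul1r; case: (vertex_pt (high i)) => x y /=.
  by congr (_, _); ring.
- move=> e v t /ring_arcE[i _ ->] tI; rewrite arcE => /ring_region_inj[].
  + exact: block_chord_region (nth_block_edge i) tI.
  + by apply: block_pt_region; rewrite ltn_mod.
  by move=> _; apply: block_chord_off_points => //; [exact: nth_block_edge|rewrite ltn_mod].
move=> e e' s t /ring_arcE[i -> ->] /ring_arcE[j -> ->] ij sI tI; rewrite !arcE.
move=> /ring_region_inj[]; rewrite ?block_chord_region ?nth_block_edge // => qE.
apply: block_chords_disjoint; rewrite ?nth_block_edge //.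
apply: contraNneq ij => rE; apply/eqP; congr (ring_edge _); apply/val_inj => /=.
rewrite (divn_eq i 48) (divn_eq j 48) qE; congr (_ + _)%N.
have /(uniqP (0, 0)%N) : uniq block_edges by [].
by apply; rewrite ?inE ?ltn_mod.
Qed.

End RingDrawing.

(** * The planar Turan number *)

Lemma planar_theta4_free_edges (R : realType) (V : finType) (G : sgraph V) :
  planar R G -> Defs.free (Theta 4) G -> (4 <= #|V|)%N ->
  (5 * #|edges G| + 24 <= 12 * #|V|)%N.
Proof. by move=> /planar_dual[F [l [r [ev span]]]]; apply: dual_edge_bound ev span. Qed.

Lemma ex_planar_theta4_le (R : realType) (n : nat) : (4 <= n)%N ->
  (5 * ex_planar R n (Theta 4) + 24 <= 12 * n)%N.
Proof.
move=> n4; suff : (ex_planar R n (Theta 4) <= (12 * n - 24) %/ 5)%N by lia.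
apply/bigmax_leqP => G /asboolP[plG freeG].
by have := planar_theta4_free_edges plG freeG; rewrite card_ord => /(_ n4); lia.
Qed.

Lemma ex_planar_theta4_ge (R : realType) (k : nat) :
  (48 * k + 24 <= ex_planar R (20 * k + 11).+1 (Theta 4))%N.
Proof.
rewrite -(card_ring_edges k).
apply: (@leq_bigmax_cond _ (fun G => `[< planar R G /\ Defs.free (Theta 4) G >])
  (fun G => #|edges G|)); apply/asboolP; split.
  by exists (fun v : 'I_(20 * k + 11).+1 => vertex_pt R v), (@ring_arc R k); apply: ring_drawing.
exact/apex_theta4_free/ring_apex.
Qed.

Theorem theorem2p1 (R : realType) (n : nat) (hn : (4 <= n)%N) :
  (ex_planar R n (Theta 4))%:R <= 12 * (n%:R - 2) / 5 :> rat /\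
  (n = 12 %[mod 20] ->
   (ex_planar R n (Theta 4))%:R = 12 * (n%:R - 2) / 5 :> rat).
Proof.
have le := ex_planar_theta4_le R hn; split=> [|n12].
  have : (5 * ex_planar R n (Theta 4) + 24)%:R <= (12 * n)%:R :> rat by rewrite ler_nat.
  by rewrite natrD !natrM; lra.
have nE : n = (20 * (n %/ 20) + 11).+1 by lia.
(* For n = 20k + 12 the 48k + 24 edges attain the upper bound 12(n - 2)/5. *)
have := ex_planar_theta4_ge R (n %/ 20); rewrite -nE => ge.
have : (5 * ex_planar R n (Theta 4) + 24)%:R = (12 * n)%:R :> rat by congr _%:R; lia.
by rewrite natrD !natrM; lra.
Qed.
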